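(* Let $L_1,L_2>0$, $\Delta>0$, $\delta\ge 0$, and let $f\colon\mathbb{R}^d\to\mathbb{R}$ be twice differentiable with $L_1$-Lipschitz gradient and $L_2$-Lipschitz Hessian. There is an algorithm which, given any $x^{(0)}\in\mathbb{R}^d$ with $\Delta$-bounded sub-optimality with respect to $f$, any positive integer $n_H$, and any $0<\epsilon\le\min\{L_1^2L_2^{-1},\Delta^{2/3}L_2^{1/3}\}$, outputs an $\epsilon$-critical point of $f$ using at most $n_H$ queries to a $\delta$-approximate Hessian oracle for $f$ and at most $$O\left(\frac{\Delta L_2^{1/4}c_\delta^{1/2}}{\epsilon^{7/4}}\cdot\mathrm{poly}\log\left(\frac{c_\ell}{c_\delta}\right)\right)$$ queries to a gradient oracle for $f$, where $$c_\delta:=\min\left\{L_1,\ \delta+\frac{\Delta L_2}{n_H\epsilon}\right\},\qquad c_\ell:=\min\left\{L_1,\ \frac{L_2^2\Delta^3}{\epsilon^4}+\frac{\Delta\delta^2}{\epsilon^2}+\delta\right\}.$$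
   Context: $\|\cdot\|$ is the Euclidean norm on vectors and the $\ell_2$-operator norm on matrices. The gradient is $L_1$-Lipschitz if $\|\nabla f(x)-\nabla f(y)\|\le L_1\|x-y\|$ for all $x,y$; the Hessian is $L_2$-Lipschitz if $\|\nabla^2 f(x)-\nabla^2 f(y)\|\le L_2\|x-y\|$ for all $x,y$. A point $x$ is $\epsilon$-critical for $f$ if $\|\nabla f(x)\|\le\epsilon$. A point $x^{(0)}$ has $\Delta$-bounded sub-optimality with respect to $f$ if $f(x^{(0)})-\inf_{x\in\mathbb{R}^d}f(x)\le\Delta$. A gradient oracle for $f$ outputs $\nabla f(x)$ when queried at $x\in\mathbb{R}^d$. A $\delta$-approximate Hessian oracle for a twice differentiable $f$ is a procedure that when queried at $x\in\mathbb{R}^d$ outputs a symmetric $H_x\in\mathbb{R}^{d\times d}$ with $\|H_x-\nabla^2 f(x)\|\le\delta$. The algorithm accesses $f$ only through these oracles and is given the parameters $L_1,L_2,\Delta,\delta,\epsilon,n_H$. $O(\cdot)$ hides a universal constant, and $\mathrm{poly}\log(z)$ denotes a fixed (universal) polynomial in $\log z$, possibly with a constant term.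
   Formalization: The gradient-query bound is proved as O(max{1, B}) with B the stated expression: for δ=0 and large n_H, B tends to 0, so the literal bound would allow no gradient query, which is impossible (f=L₁‖x‖²/2±⟨b,x⟩ share all Hessians). *)

(* Defs.v *)
From HB Require Import structures.
From mathcomp Require Import all_boot all_order all_algebra.
From mathcomp Require Import all_classical all_reals all_analysis.

Set Implicit Arguments.
Unset Strict Implicit.
Unset Printing Implicit Defensive.
Import Order.TTheory GRing.Theory Num.Theory.
Import numFieldNormedType.Exports.

Local Open Scope classical_set_scope.
Local Open Scope ring_scope.

(** Points of R^d are row vectors and a matrix [A] acts by [v |-> v *m A].
    The norm that MathComp-Analysis puts on matrices is the max norm, so the
    Euclidean and l2-operator norms are defined here; the library's notion of
    differentiability on ['rV[R]_d] does not depend on this choice. *)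

Definition norm2 (R : realType) (d : nat) (v : 'rV[R]_d) : R :=
  Num.sqrt (\sum_(i < d) v 0 i ^+ 2).

Definition opnorm2 (R : realType) (d : nat) (A : 'M[R]_d) : R :=
  sup [set norm2 (v *m A) | v in [set v : 'rV[R]_d | norm2 v <= 1]].

Definition grad (R : realType) (d : nat) (f : 'rV[R]_d -> R) (x : 'rV[R]_d) :
    'rV[R]_d :=
  \row_i 'D_(delta_mx 0 i) (f : 'rV[R]_d -> R^o) x.

(** Entry [(i, j)] is the [i]-th partial derivative of the [j]-th partial
    derivative of [f]. *)
Definition hess (R : realType) (d : nat) (f : 'rV[R]_d -> R) (x : 'rV[R]_d) :
    'M[R]_d :=
  'J (grad f) x.

Definition twice_differentiable (R : realType) (d : nat) (f : 'rV[R]_d -> R) :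
    Prop :=
  (forall x, differentiable (f : 'rV[R]_d -> R^o) x) /\
  (forall x, differentiable (grad f) x).

Definition lipschitz_grad (R : realType) (d : nat) (L1 : R)
    (f : 'rV[R]_d -> R) : Prop :=
  forall x y, norm2 (grad f x - grad f y) <= L1 * norm2 (x - y).

Definition lipschitz_hess (R : realType) (d : nat) (L2 : R)
    (f : 'rV[R]_d -> R) : Prop :=
  forall x y, opnorm2 (hess f x - hess f y) <= L2 * norm2 (x - y).

Definition critical (R : realType) (d : nat) (eps : R) (f : 'rV[R]_d -> R)
    (x : 'rV[R]_d) : Prop :=
  norm2 (grad f x) <= eps.

(** The infimum is taken in the extended reals: when [f] is not bounded below,
    no point has bounded sub-optimality. *)
Definition bounded_subopt (R : realType) (d : nat) (Delta : R)
    (f : 'rV[R]_d -> R) (x0 : 'rV[R]_d) : Prop :=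
  ((f x0)%:E - ereal_inf [set (f x)%:E | x in [set: 'rV[R]_d]] <= Delta%:E)%E.

Definition approx_hess_oracle (R : realType) (d : nat) (delta : R)
    (f : 'rV[R]_d -> R) (H : 'rV[R]_d -> 'M[R]_d) : Prop :=
  forall x, (H x)^T = H x /\ opnorm2 (H x - hess f x) <= delta.

(** A deterministic adaptive algorithm with a gradient and a Hessian oracle, as
    a decision tree: it either stops with an output, or queries an oracle at a
    point and continues according to the reply.  Only queries are counted:
    computation between queries is unrestricted. *)
Inductive oracle_prog (R : realType) (d : nat) : Type :=
| Output of 'rV[R]_d
| QueryGrad of 'rV[R]_d & ('rV[R]_d -> oracle_prog R d)
| QueryHess of 'rV[R]_d & ('M[R]_d -> oracle_prog R d).

Record outcome (R : realType) (d : nat) : Type := Outcome {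
  result : 'rV[R]_d;
  grad_queries : nat;
  hess_queries : nat
}.

Fixpoint run (R : realType) (d : nat) (G : 'rV[R]_d -> 'rV[R]_d)
    (H : 'rV[R]_d -> 'M[R]_d) (a : oracle_prog R d) : outcome R d :=
  match a with
  | Output x => Outcome x 0 0
  | QueryGrad x k =>
      let o := run G H (k (G x)) in
      Outcome (result o) (grad_queries o).+1 (hess_queries o)
  | QueryHess x k =>
      let o := run G H (k (H x)) in
      Outcome (result o) (grad_queries o) (hess_queries o).+1
  end.

(** An algorithm sees [L1 L2 Delta delta eps], the allowed number of Hessian
    queries and the initial point, but not the objective function. *)
Definition algorithm (R : realType) : Type :=
  forall d : nat, R -> R -> R -> R -> R -> nat -> 'rV[R]_d -> oracle_prog R d.

Definition c_delta (R : realType) (L1 L2 Delta delta eps : R) (nH : nat) : R :=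
  Num.min L1 (delta + Delta * L2 / (nH%:R * eps)).

Definition c_ell (R : realType) (L1 L2 Delta delta eps : R) : R :=
  Num.min L1 (L2 ^+ 2 * Delta ^+ 3 / eps ^+ 4
              + Delta * delta ^+ 2 / eps ^+ 2 + delta).

(** This tends to [0] as [nH] grows when [delta = 0], while at least one gradient
    query is needed in general; a query count that is O(rate) is therefore
    bounded by a constant times [Num.max 1 rate]. *)
Definition grad_rate (R : realType) (p : {poly R})
    (L1 L2 Delta delta eps : R) (nH : nat) : R :=
  let cd := c_delta L1 L2 Delta delta eps nH in
  let cl := c_ell L1 L2 Delta delta eps in
  Delta * L2 `^ (1 / 4) * cd `^ (1 / 2) / eps `^ (7 / 4) * p.[ln (cl / cd)].

(* Main.v *)
(** No logarithmic factor is needed: the bound holds with the constant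
    polynomial [1].  Let [sigma = sqrt (L2 * eps)] and let
    [cd = delta + Delta * L2 / (nH * eps)].

    If a symmetric matrix [K] is within [c >= sigma] of the Hessian on a ball of
    radius of order [eps / sigma], then either [K] has a direction of curvature
    below [-2c], along which a step of that length decreases [f], or
    [M = K + 4c] is positive definite.  In the latter case the heavy-ball method
    is run in the metric [M] with friction [1/T], [T] of order
    [sqrt (c / sigma)].  Its energy, written with the trapezoid rule so that the
    Lipschitz Hessian enters only through a cubic error, dissipates at least
    [eps ^ 2 / sigma] up to a constant if the path is long.  If the path stays
    short during [T] steps, a weighted average of the gradients is small by
    telescoping, it is close to the gradient at the averaged point, and one step
    along [M^-1] from there removes its components of large curvature.
    An epoch costs [T] gradients and moves by [O(eps / sigma)], so [O(Delta *
    sigma / eps ^ 2)] epochs suffice, and one Hessian per block of consecutive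
    epochs is accurate up to [O(cd + sigma)].  When [cd >= L1] the choice [K = 0],
    [c = L1] needs no Hessian.

    If [cd] is much smaller than [sigma], there are more Hessian queries than
    such epochs.  Then each query serves one regularized Newton step of length
    [O(Delta / (nH * eps))] and also transports the gradient along that step, so
    that a gradient query is needed only once the transported error
    reaches [eps / 40]. *)

Require Import Defs.
From HB Require Import structures.
From mathcomp Require Import all_boot all_order all_algebra.
From mathcomp Require Import all_classical all_reals all_analysis.
From mathcomp Require Import ring lra.
Import Order.TTheory GRing.Theory Num.Theory.
Import numFieldNormedType.Exports.
Local Open Scope classical_set_scope.
Local Open Scope ring_scope.
Set Implicit Arguments.
Unset Strict Implicit.
Unset Printing Implicit Defensive.

(** * Euclidean inner product, semidefinite forms and the operator norm *)

Section InnerProduct.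
Variables (R : realType) (d : nat).
Implicit Types (u v w : 'rV[R]_d) (A M : 'M[R]_d) (a : R).

Definition dot u v : R := (u *m v^T) 0 0.

Lemma dotE u v : dot u v = \sum_i u 0 i * v 0 i.
Proof. by rewrite /dot mxE; apply: eq_bigr => i _; rewrite mxE. Qed.

Lemma dotC u v : dot u v = dot v u.
Proof. by rewrite !dotE; apply: eq_bigr => i _; rewrite mulrC. Qed.

Lemma dotDl u v w : dot (u + v) w = dot u w + dot v w.
Proof. by rewrite /dot mulmxDl mxE. Qed.

Lemma dotZl a u w : dot (a *: u) w = a * dot u w.
Proof. by rewrite /dot -scalemxAl mxE. Qed.

Lemma dotDr u v w : dot u (v + w) = dot u v + dot u w.
Proof. by rewrite !(dotC u) dotDl. Qed.

Lemma dotZr a u w : dot u (a *: w) = a * dot u w.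
Proof. by rewrite !(dotC u) dotZl. Qed.

Lemma dotNl u w : dot (- u) w = - dot u w.
Proof. by rewrite -scaleN1r dotZl mulN1r. Qed.

Lemma dotNr u w : dot u (- w) = - dot u w.
Proof. by rewrite !(dotC u) dotNl. Qed.

Lemma dot0l w : dot 0 w = 0.
Proof. by rewrite /dot mul0mx mxE. Qed.

Lemma dot0r w : dot w 0 = 0.
Proof. by rewrite dotC dot0l. Qed.

Lemma dot_suml (I : Type) (r : seq I) (F : I -> 'rV[R]_d) w :
  dot (\sum_(i <- r) F i) w = \sum_(i <- r) dot (F i) w.
Proof. by rewrite /dot mulmx_suml summxE. Qed.

Lemma dot_sumr (I : Type) (r : seq I) (F : I -> 'rV[R]_d) w :
  dot w (\sum_(i <- r) F i) = \sum_(i <- r) dot w (F i).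
Proof. by rewrite dotC dot_suml; apply: eq_bigr => i _; rewrite dotC. Qed.

Lemma dot_mulmx_tr u v A : dot (u *m A) v = dot u (v *m A^T).
Proof. by rewrite /dot trmx_mul trmxK mulmxA. Qed.

Definition dotE_lin := (dotDl, dotDr, dotNl, dotNr, dotZl, dotZr, dot0l, dot0r).

Lemma dot_ge0 u : 0 <= dot u u.
Proof. by rewrite dotE; apply: sumr_ge0 => i _; rewrite -expr2 sqr_ge0. Qed.


Lemma norm2E u : norm2 u = Num.sqrt (dot u u).
Proof. by rewrite dotE. Qed.

Lemma norm2_ge0 u : 0 <= norm2 u.
Proof. exact: sqrtr_ge0. Qed.

Lemma norm2_sqr u : norm2 u ^+ 2 = dot u u.
Proof. by rewrite norm2E sqr_sqrtr ?dot_ge0. Qed.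

Lemma norm2_le u a : 0 <= a -> (norm2 u <= a) = (dot u u <= a ^+ 2).
Proof. by move=> a0; rewrite -norm2_sqr ler_sqr ?nnegrE ?norm2_ge0. Qed.

Definition psd M := forall u, 0 <= dot (u *m M) u.

Lemma form_sym M u v : M^T = M -> dot (u *m M) v = dot (v *m M) u.
Proof. by move=> sM; rewrite dot_mulmx_tr sM dotC. Qed.

Lemma form_young M u v : M^T = M -> psd M ->
  2 * dot (u *m M) v <= dot (u *m M) u + dot (v *m M) v.
Proof.
move=> sM /(_ (u - v)); rewrite mulmxDl mulNmx !dotE_lin (form_sym v u)//.
lra.
Qed.

Lemma form_scale M a u : dot ((a *: u) *m M) (a *: u) = a ^+ 2 * dot (u *m M) u.
Proof. by rewrite -scalemxAl dotZl dotZr; ring. Qed.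

Lemma form_cs M u v : M^T = M -> psd M ->
  dot (u *m M) v ^+ 2 <= dot (u *m M) u * dot (v *m M) v.
Proof.
move=> sM pM; set x := dot _ v; set y := dot _ u; set z := dot _ v.
have H a b : 2 * (a * b * x) <= a ^+ 2 * y + b ^+ 2 * z.
  have := form_young (a *: u) (b *: v) sM pM.
  by rewrite !form_scale -scalemxAl dotZl dotZr (mulrA a).
have y0 : 0 <= y := pM u. have z0 : 0 <= z := pM v.
have [z_eq0|z_neq0] := eqVneq z 0.
  have [->|x_neq0] := eqVneq x 0; first by rewrite z_eq0 mulr0 expr0n.
  have := H 1 ((y + 1) / (2 * x)); rewrite z_eq0 mulr0 addr0 expr1n !mul1r.
  have -> : (y + 1) / (2 * x) * x = (y + 1) / 2 by field.
  lra.
have z_gt0 : 0 < z by rewrite lt0r z_neq0.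
have := H z x; nra.
Qed.

Lemma form_cs_sqrt M u v : M^T = M -> psd M ->
  dot (u *m M) v <= Num.sqrt (dot (u *m M) u) * Num.sqrt (dot (v *m M) v).
Proof.
move=> sM pM; rewrite -sqrtrM ?pM//; apply: le_trans (ler_norm _) _.
by rewrite -sqrtr_sqr ler_wsqrtr// form_cs.
Qed.

(** Expand the double sum and apply [form_young] to each pair. The factor [n] is what later turns a
    sum of squared steps into a bound on the displacement. *)
Lemma form_sum_le M (n : nat) (F : nat -> 'rV[R]_d) : M^T = M -> psd M ->
  dot ((\sum_(k < n) F k) *m M) (\sum_(k < n) F k)
    <= n%:R * \sum_(k < n) dot (F k *m M) (F k).
Proof.
move=> sM pM; rewrite mulmx_suml dot_suml.
have -> : n%:R * \sum_(k < n) dot (F k *m M) (F k) =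
  \sum_(i < n) \sum_(j < n)
    (dot (F i *m M) (F i) + dot (F j *m M) (F j)) / 2.
  under [RHS]eq_bigr => i _ do
    rewrite -mulr_suml big_split/= sumr_const card_ord.
  rewrite -mulr_suml big_split/= sumr_const card_ord sumrMnl -mulr_natl.
  by field.
apply: ler_sum => i _; rewrite dot_sumr; apply: ler_sum => j _.
by rewrite ler_pdivlMr// mulrC form_young.
Qed.

Lemma psd1 : psd 1%:M.
Proof. by move=> u; rewrite mulmx1 dot_ge0. Qed.

Lemma cauchy_schwarz u v : dot u v <= norm2 u * norm2 v.
Proof.
rewrite !norm2E; have := form_cs_sqrt u v (trmx1 _ _) psd1.
by rewrite !mulmx1.
Qed.

Lemma norm2D u v : norm2 (u + v) <= norm2 u + norm2 v.
Proof.
rewrite norm2_le ?addr_ge0 ?norm2_ge0// !dotE_lin -!norm2_sqr (dotC v u).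
by have := cauchy_schwarz u v; nra.
Qed.

Lemma norm2Z a u : norm2 (a *: u) = `|a| * norm2 u.
Proof.
by rewrite !norm2E dotZl dotZr mulrA -expr2 sqrtrM ?sqr_ge0// sqrtr_sqr.
Qed.

Lemma norm2N u : norm2 (- u) = norm2 u.
Proof. by rewrite -scaleN1r norm2Z normrN1 mul1r. Qed.

Lemma norm2_distC u v : norm2 (u - v) = norm2 (v - u).
Proof. by rewrite -norm2N opprB. Qed.

Lemma norm2_triangle v u w : norm2 (u - w) <= norm2 (u - v) + norm2 (v - w).
Proof. by rewrite -(subrKA v u); exact: norm2D. Qed.

Lemma norm2_0 : norm2 (0 : 'rV[R]_d) = 0.
Proof. by rewrite norm2E dot0l sqrtr0. Qed.

Lemma norm2_eq0 u : norm2 u = 0 -> u = 0.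
Proof.
move=> u0; apply/rowP => i; rewrite mxE; apply/eqP; rewrite -sqrf_eq0.
have : dot u u = 0 by rewrite -norm2_sqr u0 expr0n.
rewrite dotE expr2 => u00; apply/eqP; apply: (psumr_eq0P _ u00) => // j _.
by rewrite -expr2 sqr_ge0.
Qed.

Lemma norm2_sum (I : Type) (r : seq I) (F : I -> 'rV[R]_d) :
  norm2 (\sum_(i <- r) F i) <= \sum_(i <- r) norm2 (F i).
Proof.
apply: (big_ind2 (fun u a => norm2 u <= a)) => //; first by rewrite norm2_0.
by move=> u a v b *; apply: (le_trans (norm2D _ _)); exact: lerD.
Qed.

(** Bounds the set whose [sup] defines [opnorm2], so that this [sup] is a genuine upper bound. *)
Lemma norm2_mulmx_bounded A : exists2 K : R, 0 <= K &
  forall u, norm2 (u *m A) <= K * norm2 u.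
Proof.
exists (\sum_i norm2 (row i A)) => [|u].
  by apply: sumr_ge0 => i _; exact: norm2_ge0.
rewrite mulmx_sum_row mulr_suml; apply: le_trans (norm2_sum _ _) _.
apply: ler_sum => i _; rewrite norm2Z mulrC ler_wpM2l ?norm2_ge0//.
rewrite norm2E dotE -sqrtr_sqr ler_wsqrtr// (bigD1 i)//= -expr2 lerDl.
by apply: sumr_ge0 => j _; rewrite -expr2 sqr_ge0.
Qed.

Lemma opnorm2_mulmx A u : norm2 (u *m A) <= opnorm2 A * norm2 u.
Proof.
have [K K0 HK] := norm2_mulmx_bounded A.
have [u0|u_neq0] := eqVneq (norm2 u) 0.
  by rewrite u0 mulr0 (norm2_eq0 u0) mul0mx norm2_0.
have u_gt0 : 0 < norm2 u by rewrite lt0r u_neq0 norm2_ge0.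
have -> : norm2 (u *m A) = norm2 (((norm2 u)^-1 *: u) *m A) * norm2 u.
  rewrite -scalemxAl norm2Z ger0_norm ?invr_ge0 ?norm2_ge0//.
  by rewrite mulrAC mulVf// mul1r.
rewrite ler_wpM2r ?norm2_ge0//; apply: ub_le_sup.
  exists K => _ [v /= v1 <-]; apply: le_trans (HK v) _.
  by rewrite ler_piMr.
exists ((norm2 u)^-1 *: u) => //=.
by rewrite norm2Z ger0_norm ?invr_ge0 ?norm2_ge0// mulVf.
Qed.

Lemma opnorm2_ge0 A : 0 <= opnorm2 A.
Proof.
have [K K0 HK] := norm2_mulmx_bounded A.
apply: ub_le_sup; last by exists 0; rewrite /= ?mul0mx norm2_0.
by exists K => _ [v /= v1 <-]; apply: le_trans (HK v) _; rewrite ler_piMr.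
Qed.

Lemma opnorm2_le A a u : opnorm2 A <= a -> norm2 (u *m A) <= a * norm2 u.
Proof.
by move=> Aa; apply: le_trans (opnorm2_mulmx _ _) _; rewrite ler_wpM2r ?norm2_ge0.
Qed.

Lemma unitmx_form A (c : R) : 0 < c ->
  (forall u, c * dot u u <= dot (u *m A) u) -> A \in unitmx.
Proof.
move=> c0 HA; rewrite -row_free_unit -kermx_eq0; apply/eqP/row_matrixP => i.
rewrite row0; apply: norm2_eq0; apply/eqP; rewrite -sqrf_eq0 norm2_sqr.
have := HA (row i (kermx A)).
rewrite -row_mul mulmx_ker row0 dot0l => h.
by have := dot_ge0 (row i (kermx A)); rewrite eq_le; nra.
Qed.

End InnerProduct.

(** * Taylor estimates for the function and its gradient *)

Section Calculus.
Variables (R : realType) (d : nat) (f : 'rV[R]_d -> R).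
Implicit Types (x y z u v w : 'rV[R]_d) (t c r delta : R) (K : 'M[R]_d).
Hypothesis f2 : twice_differentiable f.

Let G := grad f.

Lemma is_derive_line (W : normedModType R) (g : 'rV[R]_d -> W) x w t dg :
  is_derive (x + t *: w) w g dg -> is_derive t 1 (fun s => g (x + s *: w)) dg.
Proof.
have E : (fun h : R => h^-1 *: ((fun s : R => g (x + s *: w)) (h *: 1 + t)
            - g (x + t *: w)))
       = (fun h : R => h^-1 *: (g (h *: w + (x + t *: w)) - g (x + t *: w))).
  apply/funext => h; congr (_ *: (g _ - _)).
  by rewrite [h *: 1]mulr1 scalerDl addrCA.
by case=> gd gE; split; [move: gd | move: gE];
  rewrite /derivable /derive /shift /= E.
Qed.

Lemma is_derive_f x w t :
  is_derive t 1 (fun s => f (x + s *: w)) (dot (G (x + t *: w)) w).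
Proof.
apply: (is_derive_line (W := R^o)).
set y := x + t *: w.
have fd := f2.1 y; split; first exact: diff_derivable.
rewrite deriveE// [in LHS](row_sum_delta w) linear_sum dotE.
apply: eq_bigr => i _.
have -> : G y 0 i = 'D_(delta_mx 0 i) (f : _ -> R^o) y by rewrite mxE.
by rewrite deriveE// [LHS]linearZ; exact: mulrC.
Qed.

Lemma is_derive_dot_grad x w u t :
  is_derive t 1 (fun s => dot (G (x + s *: w)) u)
    (dot (w *m hess f (x + t *: w)) u).
Proof.
apply: (is_derive_line (W := R^o) (g := fun y => dot (G y) u)).
set y := x + _.
have Gd : differentiable G y := f2.2 y.
have Gdw : derivable G y w by exact: diff_derivable.
have Gi i : is_derive y w (fun y => G y 0 i : R^o) ((w *m hess f y) 0 i).
  split; first by move/derivable_mxP : Gdw.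
  by rewrite /hess /jacobian mul_rV_lin1 -deriveE// derive_mx// mxE.
have -> : (fun y => dot (G y) u) = \sum_i (u 0 i \*: (fun y => G y 0 i : R^o)).
  apply/funext => z; rewrite dotE fct_sumE; apply: eq_bigr => i _.
  by rewrite mulrC.
apply: is_derive_eq.
by rewrite dotE; apply: eq_bigr => i _; rewrite mulrC.
Qed.

Lemma mvt01 (phi dphi : R -> R) : (forall t, is_derive t 1 phi (dphi t)) ->
  exists2 t, 0 <= t <= 1 & phi 1 - phi 0 = dphi t.
Proof.
move=> phid.
have phic : {within `[0, 1], continuous phi}.
  apply: continuous_subspaceT => s.
  by apply: differentiable_continuous; apply/derivable1_diffP; case: (phid s).
have [t] := MVT_segment ler01 (fun t _ => phid t) phic.
by rewrite in_itv subr0 mulr1 => t01 ->; exists t.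
Qed.

(** The mean value theorem fails for vector-valued maps, so it is applied to the gradient paired
    with the remainder [u] itself. This gives [|u|^2 <= c |w| |u|], and [|u|] cancels. *)
Lemma grad_remainder x w K c :
  (forall t, 0 <= t <= 1 ->
     norm2 (w *m (hess f (x + t *: w) - K)) <= c * norm2 w) ->
  norm2 (G (x + w) - G x - w *m K) <= c * norm2 w.
Proof.
move=> Kc; set u := G _ - _ - _.
have [t t01] := mvt01 (is_derive_dot_grad x w u).
rewrite scale1r scale0r addr0 => tE.
have uu : norm2 u * norm2 u <= c * norm2 w * norm2 u.
  rewrite -expr2 norm2_sqr.
  have -> : dot u u = dot (G (x + w)) u - dot (G x) u - dot (w *m K) u.
    by rewrite -!dotNl -!dotDl.
  rewrite tE -dotNl -dotDl -mulmxBr.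
  apply: le_trans (cauchy_schwarz _ _) _.
  by rewrite ler_wpM2r ?norm2_ge0// Kc.
have [u0|u0] := eqVneq (norm2 u) 0; last first.
  by move: uu; rewrite ler_pM2r// lt0r u0 norm2_ge0.
rewrite u0; apply: le_trans (norm2_ge0 (w *m (hess f (x + 0 *: w) - K))) _.
by rewrite Kc// lexx ler01.
Qed.

Lemma grad_taylor (L2 : R) x z : 0 <= L2 -> lipschitz_hess L2 f ->
  norm2 (G z - G x - (z - x) *m hess f x) <= L2 * norm2 (z - x) ^+ 2.
Proof.
move=> L20 L2f; have := @grad_remainder x (z - x) (hess f x) (L2 * norm2 (z - x)).
rewrite subrKC expr2 mulrA; apply=> t /andP[t0 t1].
apply: opnorm2_le; apply: le_trans (L2f _ _) _.
rewrite addrAC subrr add0r norm2Z ger0_norm//.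
by rewrite ler_wpM2l// ler_piMl// norm2_ge0.
Qed.

(** The derivative of [phi] is half the Taylor remainder of the gradient, expanded about the moving
    point [x + t w] and paired with [w]. The Hessian itself cancels, and only its Lipschitz constant
    remains. *)
Lemma trapezoid (L2 : R) x w : 0 <= L2 -> lipschitz_hess L2 f ->
  f (x + w) - f x <= 2^-1 * dot (G x + G (x + w)) w + L2 / 2 * norm2 w ^+ 3.
Proof.
move=> L20 L2f.
pose phi t := f (x + t *: w) - 2^-1 * (t * dot (G x) w)
              - 2^-1 * (t * dot (G (x + t *: w)) w).
pose dphi t := dot (G (x + t *: w)) w - 2^-1 * dot (G x) w
  - 2^-1 * (t * dot (w *m hess f (x + t *: w)) w + dot (G (x + t *: w)) w).
have phid t : is_derive t 1 phi (dphi t).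
  have d1 := is_derive_f x w t.
  have d2 := is_derive_dot_grad x w w t.
  apply: is_derive_eq.
  by rewrite /dphi /GRing.scale /=; ring.
have [t /andP[t0 t1]] := mvt01 phid.
rewrite /phi /dphi !scale1r !scale0r !addr0 !mul1r mul0r mulr0 subr0 => E.
have {E} -> : f (x + w) - f x = 2^-1 * dot (G x + G (x + w)) w
    + 2^-1 * dot (G (x + t *: w) - G x - (t *: w) *m hess f (x + t *: w)) w.
  by rewrite !dotE_lin -scalemxAl dotZl; lra.
rewrite lerD2l; set u := _ - _ - _.
have nu : norm2 u <= L2 * norm2 w ^+ 2.
  have -> : u = - (G x - G (x + t *: w)
                   - (x - (x + t *: w)) *m hess f (x + t *: w)).
    have -> : x - (x + t *: w) = - (t *: w) by rewrite opprD addNKr.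
    by rewrite mulNmx opprK opprD opprB.
  rewrite norm2N; apply: le_trans (grad_taylor _ _ L20 L2f) _.
  rewrite opprD addNKr norm2N norm2Z ger0_norm// ler_wpM2l// exprMn.
  by rewrite ler_piMl ?sqr_ge0// expr_le1.
have := cauchy_schwarz u w.
have : norm2 u * norm2 w <= L2 * norm2 w ^+ 2 * norm2 w.
  by rewrite ler_wpM2r ?norm2_ge0.
by rewrite !exprS expr0; lra.
Qed.

(** Closeness of [K] to the Hessian, expressed through gradients alone. This covers both an oracle
    reply and the choice [K = 0], [c = L1]. *)
Definition almost_linear K c x r := forall y z,
  norm2 (y - x) <= r -> norm2 (z - x) <= r ->
  norm2 (G y - G z - (y - z) *m K) <= c * norm2 (y - z).

Lemma almost_linear_sub K c x r y s : norm2 (y - x) + s <= r ->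
  almost_linear K c x r -> almost_linear K c y s.
Proof.
move=> sr al u v us vs; apply: al; apply: le_trans sr.
  by apply: le_trans (norm2_triangle y _ _) _; rewrite addrC lerD2l.
by apply: le_trans (norm2_triangle y _ _) _; rewrite addrC lerD2l.
Qed.

Lemma almost_linear_hess K delta (L2 : R) x r : 0 <= L2 -> lipschitz_hess L2 f ->
  opnorm2 (K - hess f x) <= delta ->
  almost_linear K (delta + L2 * r) x r.
Proof.
move=> L20 L2f Kx y z yx zx.
have := @grad_remainder z (y - z) K (delta + L2 * r); rewrite subrKC.
apply=> t /andP[t0 t1]; set h := hess f _.
have -> : h - K = (h - hess f x) - (K - hess f x).
  by rewrite opprB subrKA.
rewrite mulmxBr (addrC delta) mulrDl; apply: le_trans (norm2D _ _) _.
rewrite norm2N lerD// opnorm2_le//; apply: le_trans (L2f _ _) _.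
rewrite ler_wpM2l//.
have -> : z + t *: (y - z) - x = t *: (y - x) + (1 - t) *: (z - x).
  by apply/rowP => i; rewrite !mxE; ring.
apply: le_trans (norm2D _ _) _; rewrite !norm2Z !ger0_norm ?subr_ge0//.
nra.
Qed.

(** Subtracting the quadratic bound before using the mean value theorem keeps the factor [1/2]: the
    derivative of [phi] is nonpositive on the whole segment. *)
Lemma almost_linear_descent K c x r y w : almost_linear K c x r ->
  norm2 (y - x) <= r -> norm2 (y + w - x) <= r ->
  f (y + w) <= f y + dot (G y) w + 2^-1 * (dot (w *m K) w + c * dot w w).
Proof.
move=> al yx ywx.
pose phi t := f (y + t *: w) - t * dot (G y) w
  - t * t * (2^-1 * (dot (w *m K) w + c * dot w w)).
pose dphi t := dot (G (y + t *: w)) w - dot (G y) w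
  - (t + t) * (2^-1 * (dot (w *m K) w + c * dot w w)).
have phid t : is_derive t 1 phi (dphi t).
  have d1 := is_derive_f y w t.
  apply: is_derive_eq.
  by rewrite /dphi /GRing.scale /=; ring.
have [t /andP[t0 t1]] := mvt01 phid.
rewrite /phi /dphi !scale1r !scale0r !addr0 !mul1r mul0r !mulr0 !subr0.
set u := G (y + t *: w) - G y - (y + t *: w - y) *m K.
have nu : norm2 u <= c * norm2 (t *: w).
  apply: le_trans (al _ _ _ yx) _; last by rewrite addrAC subrr add0r.
  have -> : y + t *: w - x = t *: (y + w - x) + (1 - t) *: (y - x).
    by apply/rowP => i; rewrite !mxE; ring.
  apply: le_trans (norm2D _ _) _; rewrite !norm2Z !ger0_norm ?subr_ge0//.
  nra.
have : dot u w <= c * t * dot w w.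
  apply: le_trans (cauchy_schwarz _ _) _; rewrite -norm2_sqr expr2.
  rewrite norm2Z ger0_norm// in nu.
  by rewrite mulrA ler_wpM2r ?norm2_ge0// -mulrA.
have -> : u = G (y + t *: w) - G y - t *: (w *m K).
  by rewrite /u [y + _ - y]addrC addKr scalemxAl.
by rewrite !dotE_lin; lra.
Qed.

End Calculus.

(** * The shifted model Hessian as a metric *)

Section RegularizedMetric.
Variables (R : realType) (d : nat) (K : 'M[R]_d) (c : R).
Implicit Types (u v w : 'rV[R]_d).
Hypotheses (Ksym : K^T = K) (c_gt0 : 0 < c).
Hypothesis K_curv : forall u, - (2 * c) * dot u u <= dot (u *m K) u.

(** With curvature of [K] at least [-2c], the shift leaves [metric >= 2c]. It also dominates
    [K + c], so a function that is [almost_linear] for [K] and [c] is 1-smooth in this metric. *)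
Definition metric : 'M[R]_d := K + (4 * c)%:M.
Let M := metric.

Lemma metric_sym : M^T = M.
Proof. by rewrite /M /metric linearD /= Ksym tr_scalar_mx. Qed.

Lemma mulmx_metric u : u *m M = u *m K + (4 * c) *: u.
Proof. by rewrite mulmxDr mul_mx_scalar. Qed.

Lemma metric_formE u : dot (u *m M) u = dot (u *m K) u + 4 * c * dot u u.
Proof. by rewrite mulmx_metric dotDl dotZl. Qed.

Lemma metric_ge u : 2 * c * dot u u <= dot (u *m M) u.
Proof. by rewrite metric_formE; have := K_curv u; lra. Qed.

Lemma metric_psd : psd M.
Proof.
move=> u; apply: le_trans (metric_ge u).
by rewrite !mulr_ge0 ?dot_ge0// ltW.
Qed.

Lemma metric_unit : M \in unitmx.
Proof.
by apply: (@unitmx_form _ _ _ (2 * c)); [rewrite mulr_gt0 | exact: metric_ge].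
Qed.

Lemma norm2_le_metric u a : 0 <= a -> dot (u *m M) u <= 2 * c * a ^+ 2 ->
  norm2 u <= a.
Proof.
move=> a0 ua; rewrite norm2_le// -(ler_pM2l (_ : 0 < 2 * c)) ?mulr_gt0//.
exact: le_trans (metric_ge u) ua.
Qed.

Lemma metric_smooth u : dot (u *m K) u + c * dot u u <= dot (u *m M) u.
Proof.
have : 0 <= c * dot u u by rewrite mulr_ge0 ?dot_ge0// ltW.
by rewrite metric_formE; lra.
Qed.

End RegularizedMetric.

(** * The heavy-ball method in the regularized metric *)

Lemma norm2_wsum (R : realType) (d n : nat) (a : nat -> R)
    (F : nat -> 'rV[R]_d) (b : R) :
  (forall k, (k < n)%N -> 0 <= a k) -> (forall k, (k < n)%N -> norm2 (F k) <= b) ->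
  norm2 (\sum_(k < n) a k *: F k) <= (\sum_(k < n) a k) * b.
Proof.
move=> a0 Fb; apply: le_trans (norm2_sum _ _) _; rewrite mulr_suml.
by apply: ler_sum => k _; rewrite norm2Z ger0_norm ?a0// ler_wpM2l ?a0 ?Fb.
Qed.

(** Caps the length in the metric at [2 * sqrt (2 * c * rho ^ 2)]. Where the metric is at least
    [2c], this keeps the Euclidean length within [2 * rho]. *)
Definition capped (R : realType) (d : nat) (K : 'M[R]_d) (c rho : R)
    (w : 'rV[R]_d) : 'rV[R]_d :=
  let q := dot (w *m metric K c) w in
  if q <= 4 * (2 * c * rho ^+ 2) then w
  else (2 * Num.sqrt (2 * c * rho ^+ 2) / Num.sqrt q) *: w.

Section HeavyBall.
Variables (R : realType) (d : nat) (f : 'rV[R]_d -> R).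
Variables (K : 'M[R]_d) (c L2 rho : R) (x0 : 'rV[R]_d) (T : nat).
Implicit Types (u v w : 'rV[R]_d).

Let G := grad f.
Let M := metric K c.
Let q u := dot (u *m M) u.
Let beta : R := 1 - T%:R^-1.

Variables X V : nat -> 'rV[R]_d.
Hypotheses (X_0 : X 0 = x0) (V_0 : V 0 = 0).
Hypothesis hb_posS : forall k, X k.+1 = X k + V k.+1.
Hypothesis hb_velS : forall k, V k.+1 = beta *: V k - G (X k) *m invmx M.

(** Squares are summed because friction dissipates exactly this quantity. By [form_sum_le], the
    condition [k * hb_length k <= 2 * c * rho ^ 2] confines [X k] to the ball of radius [rho]. *)
Definition hb_length k : R := \sum_(j < k) q (V j.+1).

Local Notation S := hb_length.
Let B2 := 2 * c * rho ^+ 2.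

Hypotheses (f2 : twice_differentiable f) (L2f : lipschitz_hess L2 f).
Hypotheses (L2_ge0 : 0 <= L2) (rho_gt0 : 0 < rho).
Hypotheses (Ksym : K^T = K) (c_gt0 : 0 < c).
Hypothesis K_curv : forall u, - (2 * c) * dot u u <= dot (u *m K) u.
Hypothesis K_lin : almost_linear f K c x0 (5 * rho).
Hypotheses (T_gt0 : (0 < T)%N) (T_le : T%:R * (L2 * rho) <= c).

Let theta : R := T%:R^-1.
Let TR_gt0 : 0 < T%:R :> R. Proof. by rewrite ltr0n. Qed.
Let theta_gt0 : 0 < theta. Proof. by rewrite invr_gt0. Qed.
Let theta_le1 : theta <= 1.
Proof. by rewrite invf_le1// ler1n. Qed.
Let beta_ge0 : 0 <= beta. Proof. by rewrite subr_ge0. Qed.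
Let beta_le1 : beta <= 1. Proof. by rewrite lerBlDr lerDl ltW. Qed.
Let Msym : M^T = M. Proof. exact: metric_sym. Qed.
Let Mpsd : psd M. Proof. exact: metric_psd. Qed.
Let q_ge0 u : 0 <= q u. Proof. exact: Mpsd. Qed.
Let B2_gt0 : 0 < B2. Proof. by rewrite !mulr_gt0// exprn_gt0. Qed.

(** Solves [lam * (1 + beta) = beta], which makes the cross terms of one step of the potential
    collapse to a multiple of [p k.+1 + beta * p k]. *)
Let lam : R := beta / (1 + beta).
Let lamE : lam * (1 + beta) = beta.
Proof. by rewrite divfK// gt_eqF// ltr_wpDr. Qed.
Let lam_ge0 : 0 <= lam. Proof. by rewrite divr_ge0// addr_ge0. Qed.
Let lam_half : lam <= 1 / 2.
Proof. by rewrite ler_pdivrMr ?ltr_wpDr//; have := beta_le1; lra. Qed.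
Let lam_beta : lam <= beta.
Proof. by rewrite ler_pdivrMr ?ltr_wpDr// ler_peMr// lerDl. Qed.

Lemma hb_grad k : G (X k) = (beta *: V k - V k.+1) *m M.
Proof.
rewrite hb_velS opprB [X in X *m M]addrC subrK mulmxKV//.
exact: metric_unit.
Qed.

Lemma hb_lengthS k : S k.+1 = S k + q (V k.+1).
Proof. by rewrite /hb_length big_ord_recr. Qed.

Lemma hb_length_ge0 k : 0 <= S k.
Proof. by apply: sumr_ge0. Qed.

Lemma hb_stepE k : X k - x0 = \sum_(j < k) V j.+1.
Proof.
elim: k => [|k IH]; first by rewrite big_ord0 X_0 subrr.
by rewrite big_ord_recr/= -IH hb_posS addrAC.
Qed.

Lemma hb_length_pred k : k.+1%:R * S k.+1 <= B2 -> k%:R * S k <= B2.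
Proof.
apply: le_trans; rewrite ler_pM ?ler0n ?hb_length_ge0 ?ler_nat//.
by rewrite hb_lengthS lerDl.
Qed.

Lemma hb_length_le j k : (j <= k)%N -> k%:R * S k <= B2 -> j%:R * S j <= B2.
Proof.
elim: k => [|k IH]; first by rewrite leqn0 => /eqP ->.
by rewrite leq_eqVlt => /predU1P[->//|jk] /hb_length_pred; exact: IH.
Qed.

Lemma hb_near k : k%:R * S k <= B2 -> norm2 (X k - x0) <= rho.
Proof.
move=> kS; apply: (norm2_le_metric c_gt0 K_curv (ltW rho_gt0)).
rewrite hb_stepE; apply: le_trans kS.
by apply: (form_sum_le _ (fun j => V j.+1)).
Qed.

Lemma hb_vel_le k : q (V k) <= S k.
Proof.
case: k => [|k]; last by rewrite hb_lengthS lerDr hb_length_ge0.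
by rewrite /q V_0 mul0mx dot0l hb_length_ge0.
Qed.

Lemma hb_length_B2 k : k%:R * S k <= B2 -> S k <= B2.
Proof.
case: k => [_|k]; first by rewrite /hb_length big_ord0 ltW.
by apply: le_trans; rewrite ler_peMl ?hb_length_ge0// ler1n.
Qed.

Let p k := dot (V k.+1 *m M) (V k).

(** The potential of the heavy-ball dynamics.  The one-sided bound
    [p k.+1 + beta * p k >= 0], which comes from the smoothness of [f] in the
    metric [M], makes the friction dissipate energy along every direction. *)
Lemma hb_potential k : k%:R * S k <= B2 ->
  f (X k) + theta / 4 * S k + lam * p k <= f x0.
Proof.
elim: k => [_|k IH kS].
  by rewrite /hb_length big_ord0 /p V_0 dot0r !mulr0 !addr0 X_0.
have kS' := hb_length_pred kS.
have {}IH := IH kS'; apply: le_trans IH.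
set Q := q (V k.+1).
have Q0 : 0 <= Q by exact: q_ge0.
have near0 := hb_near kS'. have near1 := hb_near kS.
have nearW u : norm2 u <= rho -> norm2 u <= 5 * rho.
  by move=> h; apply: le_trans h _; have := rho_gt0; lra.
have nV : norm2 (V k.+1) <= rho.
  apply: (norm2_le_metric c_gt0 K_curv (ltW rho_gt0)).
  by apply: le_trans (hb_vel_le _) (hb_length_B2 kS).
have g0 : dot (G (X k)) (V k.+1) = beta * p k - Q.
  rewrite hb_grad mulmxDl mulNmx dotDl dotNl -scalemxAl dotZl.
  by rewrite (form_sym _ _ Msym).
have g1 : dot (G (X k.+1)) (V k.+1) = beta * Q - p k.+1.
  by rewrite hb_grad mulmxDl mulNmx dotDl dotNl -scalemxAl dotZl.
(* Smoothness in the metric bounds the gradient increment paired with [V k.+1] by [Q]. By [g0] and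
   [g1] this even gives [p k.+1 + beta * p k >= beta * Q]. *)
have smooth : 0 <= p k.+1 + beta * p k.
  have al := K_lin (nearW _ near1) (nearW _ near0).
  have E : X k.+1 - X k = V k.+1 by rewrite hb_posS addrAC subrr add0r.
  rewrite E in al.
  have := cauchy_schwarz (G (X k.+1) - G (X k) - V k.+1 *m K) (V k.+1).
  rewrite !(dotDl, dotNl) g0 g1 => cs.
  have : norm2 (G (X k.+1) - G (X k) - V k.+1 *m K) * norm2 (V k.+1)
         <= c * dot (V k.+1) (V k.+1).
    by rewrite -norm2_sqr expr2 mulrA ler_wpM2r ?norm2_ge0.
  have := metric_smooth K c_gt0 (V k.+1).
  rewrite -/(q _) -/Q.
  have : 0 <= beta * Q by rewrite mulr_ge0.
  lra.
have tr := trapezoid f2 (X k) (V k.+1) L2_ge0 L2f.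
rewrite dotDl -hb_posS g0 g1 in tr.
(* Friction contributes [theta / 2 * Q]. The cubic error takes at most half of it because
   [T * L2 * rho <= c]. *)
have err : L2 / 2 * norm2 (V k.+1) ^+ 3 <= theta / 4 * Q.
  have : 2 * c * norm2 (V k.+1) ^+ 2 <= Q.
    by rewrite norm2_sqr (metric_ge K_curv).
  set a := norm2 _ in nV *.
  have a0 : 0 <= a by exact: norm2_ge0.
  have Lc : L2 * rho <= theta * c.
    by rewrite ler_pdivlMl.
  rewrite exprSr => aQ.
  have : L2 * a <= theta * c by apply: le_trans Lc; rewrite ler_wpM2l.
  move=> /(ler_wpM2r (sqr_ge0 a)).
  move: aQ => /(ler_wpM2l (ltW theta_gt0)).
  lra.
rewrite hb_lengthS -/Q.
have lamp : 1 / 2 * (beta * p k - p k.+1) + lam * p k.+1 - lam * p k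
   = - (1 / 2 - lam) * (p k.+1 + beta * p k).
  have h : lam * p k = (beta - lam * beta) * p k.
    by congr (_ * _); have := lamE; lra.
  lra.
have : 0 <= (1 / 2 - lam) * (p k.+1 + beta * p k).
  by rewrite mulr_ge0// subr_ge0.
have th : beta = 1 - theta by [].
have : (beta - 1) * Q = - (theta * Q) by rewrite th; ring.
lra.
Qed.

(** The step that would make the path too long is replaced by a capped gradient step in the metric.
    Its decrease pays for the cross term [lam * p k] of the potential, which has no sign. *)
Lemma hb_stop k (w := G (X k) *m invmx M) (z := X k - capped K c rho w) :
  (k < T)%N -> k%:R * S k <= B2 -> B2 < k.+1%:R * S k.+1 ->
  norm2 (z - x0) <= 3 * rho /\ f z <= f x0 - B2 / (12 * T%:R ^+ 2).
Proof.
move=> kT kS kS1.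
have pot := hb_potential kS; have near := hb_near kS.
set D := V k in pot; set Q := q D; set gam := q w.
have Q0 : 0 <= Q by exact: q_ge0.
have gam0 : 0 <= gam by exact: q_ge0.
have QS : Q <= S k := hb_vel_le k.
have SB : S k <= B2 := hb_length_B2 kS.
have S0 := hb_length_ge0 k.
have wM : w *m M = G (X k) by rewrite /w mulmxKV//; exact: metric_unit.
set y := dot (w *m M) D.
have pE : p k = beta * Q - y.
  by rewrite /p hb_velS mulmxBl dotDl dotNl -scalemxAl dotZl.
have S1 : S k.+1 <= 3 * S k + 2 * gam.
  have : q (V k.+1) <= 2 * Q + 2 * gam.
    have -> : q (V k.+1) = beta * beta * Q - 2 * beta * y + gam.
      rewrite /q hb_velS mulmxBl !(dotDl, dotNl, dotDr, dotNr).
      rewrite -!scalemxAl !(dotZl, dotZr) (form_sym D w Msym).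
      by rewrite -/(q D) -/(q w) -/y -/Q -/gam; ring.
    have : beta * beta * Q <= 1 * Q by rewrite ler_wpM2r// mulr_ile1.
    have := form_young (- beta *: D) w Msym Mpsd.
    rewrite form_scale -scalemxAl dotZl (form_sym D w Msym) -/y.
    rewrite -/(q D) -/(q w) -/Q -/gam.
    have -> : (- beta) ^+ 2 = beta * beta by rewrite sqrrN expr2.
    lra.
  by rewrite hb_lengthS; lra.
have T2 : B2 / (12 * T%:R ^+ 2) <= B2.
  rewrite ler_pdivrMr ?mulr_gt0 ?exprn_gt0// ler_peMr// ?ltW//.
  have : 1 <= T%:R ^+ 2 :> R by rewrite exprn_ege1// ler1n.
  by lra.
have desc u : norm2 u <= 2 * rho ->
  norm2 (X k - u - x0) <= 3 * rho /\
  f (X k - u) <= f (X k) - dot (w *m M) u + 1 / 2 * q u.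
  move=> nu.
  have n3 : norm2 (X k - u - x0) <= 3 * rho.
    rewrite addrAC; apply: le_trans (norm2D _ _) _; rewrite norm2N.
    by have := rho_gt0; lra.
  split=> //; rewrite wM.
  have := almost_linear_descent f2 (y := X k) (w := - u) K_lin.
  move=> /(_ _ _)/le_trans; apply.
  - by apply: le_trans near _; have := rho_gt0; lra.
  - by apply: le_trans n3 _; have := rho_gt0; lra.
  rewrite dotNr mulNmx dotNl !dotNr opprK dotNl opprK.
  by have := metric_smooth K c_gt0 u; rewrite -/(q u); lra.
rewrite /z /capped -/M -/(q w) -/gam -/B2; case: ifP => [gamB|/negbT gamB].
  have [|z3 fz] := desc w.
    apply: (norm2_le_metric c_gt0 K_curv); first by have := rho_gt0; lra.
    apply: le_trans gamB _; rewrite /B2; lra.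
  split=> //.
  have lamy : lam * y <= gam / 4 + lam * beta * Q.
    have : lam * lam * Q <= lam * beta * Q.
      by rewrite ler_wpM2r// ler_wpM2l.
    have := form_young (2^-1 *: w) (lam *: D) Msym Mpsd.
    rewrite !form_scale -scalemxAl dotZl dotZr -/y -/(q D) -/(q w) -/Q -/gam.
    by rewrite !expr2; lra.
  have thS : theta * (3 * S k + 3 * gam) <= theta * 3 * S k + 3 * gam.
    have : theta * gam <= 1 * gam by rewrite ler_wpM2r.
    lra.
  (* Origin of the 12: the decrease is at least [theta / 4 * S k + gam / 4], and twelve times this
     bounds [theta * S k.+1] by [S1]. *)
  have : B2 / T%:R ^+ 2 <= theta * S k.+1.
    rewrite /theta expr2 invfM mulrA mulrC ler_wpM2l// ler_pdivrMr//.
    apply: le_trans (ltW kS1) _; rewrite mulrC ler_wpM2l ?hb_length_ge0//.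
    by rewrite ler_nat.
  have -> : B2 / (12 * T%:R ^+ 2) = B2 / T%:R ^+ 2 / 12.
    by field; rewrite gt_eqF.
  have : theta * S k.+1 <= theta * (3 * S k + 3 * gam).
    by rewrite ler_wpM2l ?(ltW theta_gt0)//; lra.
  rewrite pE in pot; rewrite -/(q w) -/gam in fz.
  lra.
(* Capped case. With [b = sqrt B2] and [g = sqrt gam], the step gains at least [2 g b - 2 B2] and
   the cross term costs at most [g b / 2]. Since [g b >= 2 B2], a decrease of [B2] remains. *)
rewrite -ltNge in gamB.
have b0 : 0 < Num.sqrt B2 by rewrite sqrtr_gt0.
have bb : Num.sqrt B2 * Num.sqrt B2 = B2 by rewrite -expr2 sqr_sqrtr// ltW.
have gg : Num.sqrt gam * Num.sqrt gam = gam by rewrite -expr2 sqr_sqrtr.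
have gb : 2 * Num.sqrt B2 < Num.sqrt gam.
  have sq4 (a : R) : Num.sqrt (2 ^+ 2 * a) = 2 * Num.sqrt a.
    by rewrite sqrtrM ?sqr_ge0// sqrtr_sqr ger0_norm.
  rewrite -sq4 (_ : 2 ^+ 2 = 4); last by ring.
  by rewrite ltr_sqrt// (lt_trans _ gamB)// mulr_gt0.
set b := Num.sqrt B2 in b0 bb gb *; set g := Num.sqrt gam in gg gb *.
have g0 : 0 < g by apply: lt_trans gb; rewrite mulr_gt0.
have qs : q ((2 * b / g) *: w) = 4 * B2.
  rewrite /q form_scale -/(q w) -/gam -gg -bb; field; exact: lt0r_neq0.
have [|z3 fz] := desc ((2 * b / g) *: w).
  apply: (norm2_le_metric c_gt0 K_curv); first by have := rho_gt0; lra.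
  by rewrite -/(q _) qs /B2; lra.
split=> //.
have yle : lam * y <= 1 / 2 * (g * b).
  have yb : y <= g * b.
    apply: le_trans (form_cs_sqrt _ _ Msym Mpsd) _.
    rewrite ler_wpM2l ?sqrtr_ge0// ler_wsqrtr//.
    exact: le_trans QS SB.
  apply: le_trans (ler_wpM2l lam_ge0 yb) _.
  by rewrite ler_wpM2r// mulr_ge0// ltW.
have gbB : 2 * B2 <= g * b by rewrite -bb mulrA ler_pM2r// ltW.
rewrite qs dotZr -/(q w) -/gam in fz.
have sg : 2 * b / g * gam = 2 * (g * b).
  by rewrite -gg; field; exact: lt0r_neq0.
rewrite sg in fz; rewrite pE in pot.
have : 0 <= lam * (beta * Q) by rewrite mulr_ge0// mulr_ge0.
have : 0 <= theta / 4 * S k by rewrite mulr_ge0// divr_ge0// ltW.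
lra.
Qed.

(** Linearly decreasing weights make the weighted gradient average telescope
    into velocities with bounded coefficients and no boundary term. *)
Let wt (k : nat) : R := T%:R - k%:R.
Let W : R := \sum_(k < T) wt k.

Lemma wt_ge0 k : (k <= T)%N -> 0 <= wt k.
Proof. by move=> kT; rewrite subr_ge0 ler_nat. Qed.

Lemma wt_sum_ge : T%:R ^+ 2 / 2 <= W.
Proof.
have H n : \sum_(k < n) wt k = n%:R * T%:R - n%:R * (n%:R - 1) / 2.
  elim: n => [|n IH]; first by rewrite big_ord0; ring.
  by rewrite big_ord_recr/= IH /wt -natr1; field.
rewrite /W H expr2; have := TR_gt0; lra.
Qed.

Lemma hb_wsum_grad n :
  \sum_(k < n) wt k *: (G (X k) *m invmx M)
  = - \sum_(k < n) (wt k - beta * wt k.+1) *: V k.+1 - (beta * wt n) *: V n.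
Proof.
elim: n => [|n IH]; first by rewrite !big_ord0 V_0 scaler0 subr0 oppr0.
rewrite !big_ord_recr/= IH.
have -> : G (X n) *m invmx M = beta *: V n - V n.+1.
  by rewrite hb_velS opprB addrC subrK.
by apply/rowP => i; rewrite !mxE; ring.
Qed.

(** Averaging commutes with the linear part of the gradient, so [gbar] misses the gradient at [xbar]
    only to second order. The step [wbar] has length at most [4 rho / T^2]. Taking it leaves an
    error [c] from the model and [4c] from the shift, whence the factor 20. *)
Lemma hb_average
    (xbar := W^-1 *: \sum_(k < T) wt k *: X k)
    (gbar := W^-1 *: \sum_(k < T) wt k *: G (X k)) :
  T%:R * S T <= B2 ->
  norm2 (G (xbar - gbar *m invmx M))
    <= 20 * c * rho / T%:R ^+ 2 + 2 * L2 * rho ^+ 2.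
Proof.
move=> TS.
have T2 : 0 < T%:R ^+ 2 :> R by rewrite exprn_gt0.
have W_gt0 : 0 < W by apply: lt_le_trans wt_sum_ge; rewrite divr_gt0.
have nearX k : (k <= T)%N -> norm2 (X k - x0) <= rho.
  by move=> kT; exact: hb_near (hb_length_le kT TS).
have avg (F : nat -> 'rV[R]_d) b : (forall k, (k < T)%N -> norm2 (F k) <= b) ->
    norm2 (W^-1 *: \sum_(k < T) wt k *: F k) <= b.
  move=> Fb; rewrite norm2Z ger0_norm ?invr_ge0 ?(ltW W_gt0)// ler_pdivrMl//.
  by apply: norm2_wsum => // k kT; apply: wt_ge0; exact: ltnW.
(* The linear reference is the true Hessian, which is not queried here. With [K] instead, the error
   would be of order [c * rho], not [L2 * rho ^ 2]. *)
set A := hess f x0.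
have xbarE : xbar - x0 = W^-1 *: \sum_(k < T) wt k *: (X k - x0).
  under eq_bigr => k _ do rewrite scalerBr.
  rewrite big_split/= sumrN -scaler_suml scalerBr scalerA mulVf ?gt_eqF//.
  by rewrite scale1r.
have nxbar : norm2 (xbar - x0) <= rho.
  by rewrite xbarE; apply: (avg (fun k => X k - x0)) => k /ltnW; exact: nearX.
have tay y : norm2 (y - x0) <= rho ->
    norm2 (G y - G x0 - (y - x0) *m A) <= L2 * rho ^+ 2.
  move=> yr; apply: le_trans (grad_taylor f2 _ _ L2_ge0 L2f) _.
  by rewrite ler_wpM2l// ler_sqr ?nnegrE ?norm2_ge0// ltW.
have gbarE : gbar - G x0 - (xbar - x0) *m A
    = W^-1 *: \sum_(k < T) wt k *: (G (X k) - G x0 - (X k - x0) *m A).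
  under eq_bigr => k _ do rewrite !scalerBr.
  rewrite !big_split/= !sumrN -scaler_suml !scalerBr scalerA mulVf ?gt_eqF//.
  rewrite scale1r xbarE -scalemxAl mulmx_suml; congr (_ - _ *: _).
  by apply: eq_bigr => k _; rewrite scalemxAl.
have ngbar : norm2 (G xbar - gbar) <= 2 * L2 * rho ^+ 2.
  have -> : G xbar - gbar = (G xbar - G x0 - (xbar - x0) *m A)
      - (gbar - G x0 - (xbar - x0) *m A).
    by rewrite opprB addrA subrK opprB addrA subrK.
  apply: le_trans (norm2D _ _) _; rewrite norm2N gbarE.
  rewrite (_ : 2 * L2 * rho ^+ 2 = L2 * rho ^+ 2 + L2 * rho ^+ 2); last by ring.
  apply: lerD; first exact: tay.
  apply: (avg (fun k => G (X k) - G x0 - (X k - x0) *m A)) => k /ltnW kT.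
  by apply: tay; exact: nearX.
set wbar := gbar *m invmx M.
have wbarE : wbar
    = W^-1 *: - \sum_(k < T) (wt k - beta * wt k.+1) *: V k.+1.
  rewrite /wbar /gbar -scalemxAl mulmx_suml; congr (_ *: _).
  under eq_bigr => k _ do rewrite -scalemxAl.
  by rewrite hb_wsum_grad /wt subrr mulr0 scale0r subr0.
have nwbar : norm2 wbar <= 4 * rho / T%:R ^+ 2.
  rewrite wbarE norm2Z norm2N ger0_norm ?invr_ge0 ?(ltW W_gt0)//.
  set s := \sum_(k < T) _.
  (* The coefficients equal [1 + theta * wt k.+1] and lie in [[1, 2]], so their squares are at most
     4 and [q s <= 4 * T * S T <= 4 * B2]. *)
  have ns : norm2 s <= 2 * rho.
    apply: (norm2_le_metric c_gt0 K_curv).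
      by have := rho_gt0; lra.
    apply: le_trans (form_sum_le T (fun k => (wt k - beta * wt k.+1) *: V k.+1)
      Msym Mpsd) _.
    apply: (@le_trans _ _ (T%:R * (4 * S T))); last first.
      by move: TS; rewrite /B2; lra.
    rewrite ler_wpM2l ?ler0n// /hb_length mulr_sumr; apply: ler_sum => k _.
    rewrite form_scale -/(q _) ler_wpM2r//.
    have aE : wt k - beta * wt k.+1 = 1 + theta * wt k.+1.
      by rewrite /wt /beta -/theta -natr1; ring.
    have tw : 0 <= theta * wt k.+1 <= 1.
      rewrite mulr_ge0 ?wt_ge0 ?(ltW theta_gt0)//= /theta ler_pdivrMl// mulr1.
      by rewrite /wt lerBlDr lerDl.
    rewrite aE expr2; have /andP[t0 t1] := tw; nra.
  rewrite mulrC ler_pdivrMr//; apply: le_trans ns _.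
  have -> : 2 * rho = 4 * rho / T%:R ^+ 2 * (T%:R ^+ 2 / 2).
    by field; rewrite gt_eqF.
  by rewrite ler_wpM2l ?wt_sum_ge// divr_ge0 ?mulr_ge0// ltW.
have nwbar4 : norm2 wbar <= 4 * rho.
  apply: le_trans nwbar _; rewrite ler_pdivrMr// ler_peMr//.
    by rewrite mulr_ge0// ltW.
  by rewrite exprn_ege1// ler1n.
have nz : norm2 (xbar - wbar - x0) <= 5 * rho.
  rewrite addrAC; apply: le_trans (norm2D _ _) _; rewrite norm2N; lra.
have nxbar5 : norm2 (xbar - x0) <= 5 * rho.
  by apply: le_trans nxbar _; have := rho_gt0; lra.
have al := K_lin nz nxbar5.
have dE : xbar - wbar - xbar = - wbar by rewrite addrAC subrr add0r.
rewrite dE norm2N in al.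
have wM : wbar *m M = gbar by rewrite /wbar mulmxKV//; exact: metric_unit.
have -> : G (xbar - wbar)
    = (G (xbar - wbar) - G xbar - - wbar *m K) + (G xbar - gbar)
      + (4 * c) *: wbar.
  have -> : gbar = wbar *m K + (4 * c) *: wbar by rewrite -wM mulmx_metric.
  by rewrite mulNmx; apply/rowP => i; rewrite !mxE; ring.
apply: le_trans (norm2D _ _) _.
have nc : norm2 ((4 * c) *: wbar) = 4 * c * norm2 wbar.
  by rewrite norm2Z ger0_norm// mulr_ge0// ltW.
have := norm2D (G (xbar - wbar) - G xbar - - wbar *m K) (G xbar - gbar).
have : c * norm2 wbar <= c * (4 * rho / T%:R ^+ 2).
  by rewrite ler_wpM2l// ltW.
have -> : 20 * c * rho / T%:R ^+ 2 = 5 * (c * (4 * rho / T%:R ^+ 2)) by ring.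
rewrite nc -mulrA; lra.
Qed.

End HeavyBall.

(** * Steps along directions of negative curvature *)

Section NegativeCurvature.
Variables (R : realType) (d : nat) (f : 'rV[R]_d -> R).
Hypothesis f2 : twice_differentiable f.
Variables (K : 'M[R]_d) (c r : R).
Implicit Types (u v g x : 'rV[R]_d).

Definition neg_curv : set 'rV[R]_d :=
  [set v | norm2 v = r /\ dot (v *m K) v < - (2 * c) * r ^+ 2].

Definition downhill g v : 'rV[R]_d := if dot g v <= 0 then v else - v.

Lemma norm2_downhill g v : norm2 (downhill g v) = norm2 v.
Proof. by rewrite /downhill; case: ifP => // _; rewrite norm2N. Qed.

(** The curvature [-2c] of the model outweighs its error [c], leaving [-c r^2 / 2]. Choosing the
    sign of [v] by an inexact gradient costs at most [r * e]. *)
Lemma neg_curv_decrease x g v e :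
  almost_linear f K c x r -> norm2 (g - grad f x) <= e -> neg_curv v ->
  f (x + downhill g v) <= f x + r * e - c * r ^+ 2 / 2.
Proof.
move=> al ge [nv vK].
have r0 : 0 <= r by rewrite -nv norm2_ge0.
set s := downhill g v.
have ns : norm2 s = r by rewrite norm2_downhill.
have sK : dot (s *m K) s = dot (v *m K) v.
  rewrite /s /downhill; case: ifP => // _.
  by rewrite mulNmx dotNl dotNr opprK.
have gs : dot g s <= 0.
  rewrite /s /downhill; case: ifP => // /negbT; rewrite -ltNge dotNr => h.
  by rewrite oppr_le0 ltW.
have := almost_linear_descent f2 al (y := x) (w := s).
rewrite subrr norm2_0 [x + s - x]addrC addKr ns lexx => /(_ r0 isT)/le_trans; apply.
have : dot (grad f x - g) s <= r * e.
  apply: le_trans (cauchy_schwarz _ _) _.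
  by rewrite norm2_distC ns mulrC ler_wpM2l.
rewrite dotDl dotNl -norm2_sqr ns sK; lra.
Qed.

Lemma curv_ge u : 0 < r -> ~ (exists v, neg_curv v) ->
  - (2 * c) * dot u u <= dot (u *m K) u.
Proof.
move=> r0 nov; rewrite leNgt; apply/negP => uK; apply: nov.
have u0 : 0 < norm2 u.
  rewrite lt0r norm2_ge0 andbT; apply/eqP => /norm2_eq0 u0; move: uK.
  by rewrite u0 mul0mx dot0l mulr0 ltxx.
exists ((r / norm2 u) *: u); split.
  by rewrite norm2Z ger0_norm ?divr_ge0 ?norm2_ge0 ?ltW// divfK ?gt_eqF.
rewrite form_scale.
have -> : - (2 * c) * r ^+ 2 = (r / norm2 u) ^+ 2 * (- (2 * c) * dot u u).
  by rewrite -norm2_sqr; field; rewrite gt_eqF.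
by rewrite ltr_pM2l// exprn_gt0// divr_gt0.
Qed.

End NegativeCurvature.

(** * The oracle programs and their correctness *)

Section Programs.
Variables (R : realType) (d : nat).
Local Notation point := 'rV[R]_d.
Local Notation prog := (oracle_prog R d).
Implicit Types (x v g : point) (K : 'M[R]_d) (c rho r delta : R).

(** [n] counts the iterations left. At iteration [k] it equals [T - k], the averaging weight, and
    [T - m] is [k.+1]. A long path hands over to [next], while a path that stays short ends with a
    critical output. *)
Fixpoint momentum K c rho (T n : nat) x v (S : R) (sx sg : point)
    (next : point -> prog) : prog :=
  let M := metric K c in
  if n is m.+1 then QueryGrad x (fun g =>
    let w := g *m invmx M in
    let v' := (1 - T%:R^-1) *: v - w in
    let S' := S + dot (v' *m M) v' in
    if (T - m)%:R * S' <= 2 * c * rho ^+ 2 then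
      momentum K c rho T m (x + v') v' S'
        (sx + n%:R *: x) (sg + n%:R *: g) next
    else next (x - capped K c rho w))
  else
    let W := \sum_(k < T) (T%:R - k%:R) in
    Output (W^-1 *: sx - (W^-1 *: sg) *m invmx M).

Definition epoch K c rho (T : nat) x (next : point -> prog) : prog :=
  if `[< exists v, neg_curv K c rho v >] then
    QueryGrad x (fun g => next (x + downhill g (xget 0 (neg_curv K c rho))))
  else momentum K c rho T T x 0 0 0 0 next.

Fixpoint epochs K c rho (T m : nat) x (next : point -> prog) : prog :=
  if m is m'.+1 then
    epoch K c rho T x (fun y => epochs K c rho T m' y next)
  else next x.

(** The final [Output x] is a default value, unreachable once [J * m] epochs would decrease [f]
    below its lower bound. The same holds for [walks]. *)
Fixpoint hess_epochs c rho (T m J : nat) x : prog :=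
  if J is J'.+1 then
    QueryHess x (fun K => epochs K c rho T m x (hess_epochs c rho T m J'))
  else Output x.

(** [g] estimates the gradient at [x]; moving by [s] updates it by [s *m K]
    instead of querying the oracle. *)
Fixpoint walk c r (n : nat) x g (next : point -> prog) : prog :=
  if n is m.+1 then QueryHess x (fun K =>
    let go s := walk c r m (x + s) (g + s *m K) next in
    if `[< exists v, neg_curv K c r v >] then
      go (downhill g (xget 0 (neg_curv K c r)))
    else
      let w := g *m invmx (metric K c) in
      if norm2 w <= r then Output (x - w) else go (- ((r / norm2 w) *: w)))
  else next x.

Fixpoint walks c r (n J : nat) x : prog :=
  if J is J'.+1 then
    QueryGrad x (fun g => walk c r n x g (walks c r n J'))
  else Output x.

Variables (f : point -> R) (H : point -> 'M[R]_d) (L2 delta eps flow : R).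
Hypotheses (f2 : twice_differentiable f) (L2f : lipschitz_hess L2 f).
Hypotheses (L2_ge0 : 0 <= L2) (H_approx : approx_hess_oracle delta f H).
Hypothesis f_low : forall x, flow <= f x.

(** Programs are in continuation-passing style: a hypothesis [succeeds] on [next] carries the
    remaining query budgets. *)
Definition succeeds (ng nh : nat) (a : prog) : Prop :=
  let o := run (grad f) H a in
  [/\ critical eps f (result o), (grad_queries o <= ng)%N
    & (hess_queries o <= nh)%N].

Lemma succeeds_output ng nh x : critical eps f x -> succeeds ng nh (Output x).
Proof. by []. Qed.

Lemma succeeds_grad ng nh x k : succeeds ng nh (k (grad f x)) ->
  succeeds ng.+1 nh (QueryGrad x k).
Proof. by case. Qed.

Lemma succeeds_hess ng nh x k : succeeds ng nh (k (H x)) ->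
  succeeds ng nh.+1 (QueryHess x k).
Proof. by case. Qed.

Lemma succeeds_leq ng nh ng' a : (ng <= ng')%N -> succeeds ng nh a ->
  succeeds ng' nh a.
Proof. by move=> le [? h ?]; split=> //; exact: leq_trans h le. Qed.

Section Momentum.
Variables (c rho : R) (T : nat).
Hypotheses (c_gt0 : 0 < c) (rho_gt0 : 0 < rho).
Hypotheses (T_gt0 : (0 < T)%N) (T_le : T%:R * (L2 * rho) <= c).
Hypothesis acc : 20 * c * rho / T%:R ^+ 2 + 2 * L2 * rho ^+ 2 <= eps.

Let gain : R := 2 * c * rho ^+ 2 / (12 * T%:R ^+ 2).

Lemma momentum_succeeds K x0 ng nh next :
  K^T = K -> (forall u, - (2 * c) * dot u u <= dot (u *m K) u) ->
  almost_linear f K c x0 (5 * rho) ->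
  (forall z, norm2 (z - x0) <= 3 * rho -> f z <= f x0 - gain ->
     succeeds ng nh (next z)) ->
  succeeds (T + ng) nh (momentum K c rho T T x0 0 0 0 0 next).
Proof.
move=> Ksym Kcurv Klin Hnext.
pose M := metric K c.
(* The unstopped trajectory, to which the heavy-ball lemmas apply. [main] below shows that the
   program state after [k] iterations follows it. *)
pose hb := fix hb k : point * point := if k is j.+1 then
    let v := (1 - T%:R^-1) *: (hb j).2 - grad f (hb j).1 *m invmx M in
    ((hb j).1 + v, v) else (x0, 0).
pose X k := (hb k).1. pose V k := (hb k).2.
pose S := hb_length K c V.
have XS k : X k.+1 = X k + V k.+1 by [].
have VS k : V k.+1 = (1 - T%:R^-1) *: V k - grad f (X k) *m invmx M by [].
have stop := @hb_stop R d f K c L2 rho x0 T X V erefl erefl XS VS f2 L2f L2_ge0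
  rho_gt0 Ksym c_gt0 Kcurv Klin T_gt0 T_le.
have average := @hb_average R d f K c L2 rho x0 T X V erefl erefl XS VS f2 L2f
  L2_ge0 rho_gt0 Ksym c_gt0 Kcurv Klin T_gt0.
have SS k : S k.+1 = S k + dot (V k.+1 *m M) (V k.+1).
  by rewrite /S /hb_length big_ord_recr.
pose wt (k : nat) : R := T%:R - k%:R.
have main n k : (n + k)%N = T -> k%:R * S k <= 2 * c * rho ^+ 2 ->
    succeeds (n + ng) nh (momentum K c rho T n (X k) (V k) (S k)
      (\sum_(j < k) wt j *: X j) (\sum_(j < k) wt j *: grad f (X j)) next).
  elim: n k => [|n IH] k nkT kS.
    rewrite add0n in nkT; subst k.
    by apply: succeeds_output; apply: le_trans (average kS) acc.
  rewrite addSn /=; apply: succeeds_grad.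
  have nE : n.+1%:R = wt k by rewrite /wt -nkT natrD addrK.
  have kE : (T - n)%N = k.+1 by rewrite -nkT addSnnS addKn.
  rewrite -VS -XS -SS nE kE.
  have -> : \sum_(j < k) wt j *: X j + wt k *: X k
      = \sum_(j < k.+1) wt j *: X j by rewrite big_ord_recr.
  have -> : \sum_(j < k) wt j *: grad f (X j) + wt k *: grad f (X k)
      = \sum_(j < k.+1) wt j *: grad f (X j) by rewrite big_ord_recr.
  case: ifPn => [kS1|]; first by apply: IH; rewrite ?addnS.
  rewrite -ltNge => kS1; apply: (@succeeds_leq ng); first exact: leq_addl.
  have [|z3 fz] := stop k _ kS kS1; first by rewrite -nkT addSn ltnS leq_addl.
  exact: Hnext z3 fz.
have := main T 0 (addn0 T); rewrite mul0r !big_ord0 /S /hb_length big_ord0.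
by apply; rewrite !mulr_ge0 ?sqr_ge0// ltW.
Qed.

Lemma epoch_succeeds K x0 ng nh next :
  K^T = K -> almost_linear f K c x0 (5 * rho) ->
  (forall z, norm2 (z - x0) <= 3 * rho -> f z <= f x0 - gain ->
     succeeds ng nh (next z)) ->
  succeeds (T + ng) nh (epoch K c rho T x0 next).
Proof.
move=> Ksym Klin Hnext; rewrite /epoch; case: asboolP => [nc|nonc]; last first.
  by apply: momentum_succeeds => // u; exact: curv_ge rho_gt0 nonc.
have nv := xgetPex 0 nc; set v := xget _ _ in nv *.
apply: (@succeeds_leq ng.+1); first by rewrite -add1n leq_add2r.
apply: succeeds_grad; apply: Hnext.
  rewrite addrC addKr norm2_downhill nv.1; have := rho_gt0; lra.
have Klin1 : almost_linear f K c x0 rho.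
  by apply: almost_linear_sub Klin; rewrite subrr norm2_0; have := rho_gt0; lra.
have := @neg_curv_decrease _ _ _ f2 _ _ _ _ (grad f x0) _ 0 Klin1.
rewrite subrr norm2_0 => /(_ _ (lexx 0) nv)/le_trans; apply.
(* A curvature step gains [c * rho ^ 2 / 2], more than the [c * rho ^ 2 / (6 * T ^ 2)] of a
   heavy-ball epoch. *)
rewrite mulr0 addr0 lerD2l lerN2 /gain ler_pdivrMr; last first.
  by rewrite mulr_gt0// exprn_gt0// ltr0n.
have : 1 <= T%:R ^+ 2 :> R by rewrite exprn_ege1// ler1n.
have : 0 <= c * rho ^+ 2 by rewrite mulr_ge0 ?sqr_ge0// ltW.
nra.
Qed.

(** Each epoch that continues moves by at most [3 * rho], and every epoch needs the model on a ball
    of radius [5 * rho] around its start. *)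
Lemma epochs_succeeds K x0 ng nh next m :
  K^T = K -> almost_linear f K c x0 (m%:R * (3 * rho) + 5 * rho) ->
  (forall z, f z <= f x0 - m%:R * gain -> succeeds ng nh (next z)) ->
  succeeds (m * T + ng) nh (epochs K c rho T m x0 next).
Proof.
move=> Ksym; elim: m x0 => [|m IH] x0 Klin Hnext.
  by apply: Hnext; rewrite mul0r subr0.
rewrite mulSn -addnA /=.
apply: epoch_succeeds => //.
  apply: almost_linear_sub Klin; rewrite subrr norm2_0 add0r lerDr.
  by rewrite !mulr_ge0 ?ler0n// ltW.
move=> z z3 fz; apply: IH.
  by apply: almost_linear_sub Klin; rewrite -natr1; lra.
move=> y fy; apply: Hnext; apply: le_trans fy _.
by rewrite -natr1; lra.
Qed.

Lemma hess_epochs_succeeds m J x0 :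
  delta + L2 * (m%:R * (3 * rho) + 5 * rho) <= c ->
  f x0 - flow < (J * m)%:R * gain ->
  succeeds (J * (m * T)) J (hess_epochs c rho T m J x0).
Proof.
move=> cm; elim: J x0 => [|J IH] x0 fx0.
  (* With no blocks left, [fx0] puts [f x0] below [flow], a contradiction. *)
  by have := f_low x0; move: fx0; rewrite mul0n mul0r; lra.
rewrite /=; apply: succeeds_hess.
have [Hsym Hx] := H_approx x0.
rewrite mulSn; apply: epochs_succeeds => //.
  move=> y z yx zx; apply: le_trans (almost_linear_hess f2 L2_ge0 L2f Hx yx zx) _.
  by rewrite ler_wpM2r// norm2_ge0.
move=> z fz; apply: IH; move: fx0; rewrite mulSn natrD; lra.
Qed.

End Momentum.

Section Walk.
Variables (c r a emax : R).
Hypotheses (c_gt0 : 0 < c) (r_gt0 : 0 < r).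
Hypotheses (c_ge : delta + L2 * r <= c) (a_ge : (delta + L2 * r) * r <= a).
Hypothesis acc : 5 * c * r + emax <= eps.

Let gain : R := c * r ^+ 2 / 2 - r * emax.

(** Each transport of the gradient adds at most [a] to the error [e]. Every step that does not stop,
    whether along negative curvature or a truncated Newton step, decreases [f] by at least
    [gain]. *)
Lemma walk_succeeds n x g e ng nh next :
  norm2 (g - grad f x) <= e -> e + n%:R * a <= emax ->
  (forall z, f z <= f x - n%:R * gain -> succeeds ng nh (next z)) ->
  succeeds ng (n + nh) (walk c r n x g next).
Proof.
elim: n x g e => [|n IH] x g e ge en Hnext.
  by apply: Hnext; rewrite mul0r subr0.
rewrite addSn /=; apply: succeeds_hess.
have [Hsym Hx] := H_approx x; set K := H x in Hsym Hx *.
have lin := almost_linear_hess f2 L2_ge0 L2f Hx (r := r).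
have Klin : almost_linear f K c x r.
  move=> y z yx zx; apply: le_trans (lin y z yx zx) _.
  by rewrite ler_wpM2r// norm2_ge0.
have nx : norm2 (x - x) <= r by rewrite subrr norm2_0 ltW.
have a0 : 0 <= a.
  apply: le_trans a_ge; rewrite mulr_ge0 ?addr_ge0 ?mulr_ge0// ?(ltW r_gt0)//.
  have := opnorm2_le 0 Hx; rewrite mul0mx norm2_0 mulr0 => _.
  exact: le_trans (opnorm2_ge0 _) Hx.
have na : 0 <= n%:R * a by rewrite mulr_ge0.
have e_le : e <= emax by move: en; rewrite -natr1; lra.
have go s : norm2 s <= r -> f (x + s) <= f x - gain ->
    succeeds ng (n + nh) (walk c r n (x + s) (g + s *m K) next).
  move=> sr fs; apply: (IH _ _ (e + a)); last 1 first.
  - by move=> z fz; apply: Hnext; move: fz fs; rewrite -natr1; lra.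
  - have -> : g + s *m K - grad f (x + s)
        = (g - grad f x) - (grad f (x + s) - grad f x - s *m K).
      by apply/rowP => i; rewrite !mxE; ring.
    apply: le_trans (norm2D _ _) _; rewrite norm2N lerD//.
    have xsx : x + s - x = s by rewrite addrC addKr.
    have := lin (x + s) x; rewrite xsx => /(_ sr nx)/le_trans; apply.
    apply: le_trans a_ge; rewrite ler_wpM2l//.
    apply: le_trans (norm2_ge0 (0 : point)) _; rewrite norm2_0.
    rewrite addr_ge0 ?mulr_ge0// ?(ltW r_gt0)//.
    exact: le_trans (opnorm2_ge0 _) Hx.
  - by move: en; rewrite -natr1; lra.
case: asboolP => [nc|nonc].
  have nv := xgetPex 0 nc; set v := xget _ _ in nv *.
  apply: go; first by rewrite norm2_downhill nv.1.
  apply: le_trans (neg_curv_decrease f2 Klin ge nv) _.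
  have : r * e <= r * emax by rewrite ler_wpM2l// ltW.
  by rewrite /gain; lra.
have curv u := curv_ge u r_gt0 nonc.
set w := g *m _.
have wM : w *m metric K c = g.
  by rewrite /w mulmxKV//; exact: metric_unit.
have gE : g = w *m K + (4 * c) *: w by rewrite -[LHS]wM mulmx_metric.
(* A full Newton step of length at most [r] leaves [4 c r] from the shift, [c r] from the model and
   the error of [g], in total at most [5 c r + emax]. *)
case: ifPn => [wr|].
  apply: succeeds_output; rewrite /critical.
  have -> : grad f (x - w) = (grad f (x - w) - grad f x - - w *m K)
      - (g - grad f x) + (4 * c) *: w.
    by rewrite [in RHS]gE mulNmx; apply/rowP => i; rewrite !mxE; ring.
  have xwx : x - w - x = - w by rewrite addrC addKr.
  have := Klin (x - w) x; rewrite xwx norm2N => /(_ wr nx) al.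
  apply: le_trans (norm2D _ _) _.
  have := norm2D (grad f (x - w) - grad f x - - w *m K) (- (g - grad f x)).
  have cw : c * norm2 w <= c * r by rewrite ler_wpM2l// ltW.
  rewrite norm2Z norm2N ger0_norm; last by rewrite mulr_ge0// ltW.
  by have := acc; lra.
(* Truncated step: as [t < 1] and [q >= 2 c |w|^2], the decrease is at least
   [t q / 2 - r e >= c r^2 - r e]. *)
rewrite -ltNge => rw.
have w0 : 0 < norm2 w by apply: lt_trans rw.
set t := r / norm2 w.
have t0 : 0 < t by rewrite divr_gt0.
have t1 : t < 1 by rewrite ltr_pdivrMr// mul1r.
have tw : norm2 (t *: w) = r.
  by rewrite norm2Z ger0_norm ?(ltW t0)// divfK ?gt_eqF.
apply: go; first by rewrite norm2N tw.
have xtx : x - t *: w - x = - (t *: w) by rewrite addrC addKr.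
have := almost_linear_descent f2 Klin (y := x) (w := - (t *: w)).
rewrite xtx norm2N tw => /(_ nx (lexx r))/le_trans; apply.
rewrite mulNmx !(dotNl, dotNr) !opprK.
set q := dot (w *m metric K c) w.
have qE : dot g w = q by rewrite /q wM.
have ge' : dot (g - grad f x) (t *: w) <= r * e.
  apply: le_trans (cauchy_schwarz _ _) _.
  by rewrite tw mulrC ler_wpM2l// ltW.
rewrite dotDl dotNl dotZr qE in ge'.
have sm := metric_smooth K c_gt0 (t *: w); rewrite (form_scale (metric K c)) -/q in sm.
have q2 : 2 * c * norm2 w ^+ 2 <= q by rewrite norm2_sqr metric_ge.
have tn : t * norm2 w = r by rewrite divfK ?gt_eqF.
have tq : 2 * c * (r * norm2 w) <= t * q.
  apply: le_trans (_ : t * (2 * c * norm2 w ^+ 2) <= _).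
    by rewrite -tn expr2 le_eqVlt; apply/orP; left; apply/eqP; ring.
  by rewrite ler_wpM2l// ltW.
have rr : c * (r * r) <= c * (r * norm2 w).
  by rewrite !ler_wpM2l// ?ltW.
have ttq : t ^+ 2 * q <= t * q.
  by rewrite expr2 -mulrA ler_piMl ?(ltW t1)// mulr_ge0 ?(ltW t0)// metric_psd.
have re : r * e <= r * emax by rewrite ler_wpM2l// ltW.
have crr : 0 <= c * (r * r) by rewrite !mulr_ge0// ltW.
rewrite /gain expr2; lra.
Qed.

Lemma walks_succeeds n J x : n%:R * a <= emax ->
  f x - flow < (J * n)%:R * gain ->
  succeeds J (J * n) (walks c r n J x).
Proof.
move=> na; elim: J x => [|J IH] x fx.
  by have := f_low x; move: fx; rewrite mul0n mul0r; lra.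
rewrite /=; apply: succeeds_grad; rewrite mulSn.
apply: (@walk_succeeds _ _ _ 0); rewrite ?subrr ?norm2_0 ?add0r//.
by move=> z fz; apply: IH; move: fx; rewrite mulSn natrD; lra.
Qed.

End Walk.
End Programs.

(** * Choice of the parameters and arithmetic of the rate *)

Section Constants.
Variable R : realType.
Implicit Types (sigma eps c : R).

Definition epoch_steps sigma c : nat :=
  (Num.truncn (2 * Num.sqrt (c / sigma))).+1.

Lemma epoch_steps_bounds sigma c : 0 < sigma -> sigma <= c ->
  4 * (c / sigma) <= (epoch_steps sigma c)%:R ^+ 2
  /\ (epoch_steps sigma c)%:R <= 3 * Num.sqrt (c / sigma).
Proof.
move=> s0 sc; rewrite /epoch_steps; set k := Num.sqrt _.
have k1 : 1 <= c / sigma by rewrite ler_pdivlMr// mul1r.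
have kk : k ^+ 2 = c / sigma by rewrite sqr_sqrtr// (le_trans _ k1).
have k_ge1 : 1 <= k by rewrite -sqrtr1 ler_wsqrtr.
have k2 : 0 <= 2 * k by lra.
have /andP[] := truncn_itv k2; rewrite -natr1; set t := (_%:R : R) => Tle Tgt.
split; last lra.
by rewrite -kk; nra.
Qed.

(** Substituting [L2 = sigma ^ 2 / eps] leaves only the ratio [c / sigma], which [T ^ 2] matches up
    to the factors 4 and 9. The guaranteed gain is therefore independent of [c], which affects only
    the length of an epoch. *)
Lemma epoch_parameters sigma eps L2 c
    (rho := eps / sigma / 10) (T := epoch_steps sigma c) :
  0 < sigma -> 0 < eps -> sigma ^+ 2 = L2 * eps -> sigma <= c ->
  [/\ T%:R * (L2 * rho) <= c,
      20 * c * rho / T%:R ^+ 2 + 2 * L2 * rho ^+ 2 <= eps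
    & eps ^+ 2 / sigma / (54 * 10 ^+ 2) <= 2 * c * rho ^+ 2 / (12 * T%:R ^+ 2)].
Proof.
move=> s0 e0 sE sc.
have [T2 T3] := epoch_steps_bounds s0 sc; rewrite -/T in T2 T3.
have c0 : 0 < c by apply: lt_le_trans sc.
have T0 : 0 < T%:R :> R by rewrite ltr0n.
have TT0 : 0 < T%:R ^+ 2 :> R by rewrite exprn_gt0.
have L2E : L2 = sigma ^+ 2 / eps by rewrite sE mulfK ?gt_eqF.
have k1 : 1 <= c / sigma by rewrite ler_pdivlMr// mul1r.
set k := Num.sqrt _ in T3.
have kk : k ^+ 2 = c / sigma by rewrite sqr_sqrtr// (le_trans _ k1).
have k_ge1 : 1 <= k by rewrite -sqrtr1 ler_wsqrtr.
have cE : c = k ^+ 2 * sigma by rewrite kk divfK ?gt_eqF.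
split.
- have -> : L2 * rho = sigma / 10.
    by rewrite /rho L2E; field; rewrite !gt_eqF.
  rewrite cE mulrA [_ / 10]mulrC mulrA -mulrA.
  rewrite mulrCA mulrA ler_pM2r//; nra.
- have -> : 20 * c * rho / T%:R ^+ 2 = 2 * eps * ((c / sigma) / T%:R ^+ 2).
    by rewrite /rho; field; rewrite !gt_eqF.
  have -> : 2 * L2 * rho ^+ 2 = eps / 50.
    by rewrite /rho L2E; field; rewrite !gt_eqF.
  have : c / sigma / T%:R ^+ 2 <= 1 / 4.
    by rewrite ler_pdivrMr//; lra.
  move=> /(ler_wpM2l (ltW e0)); lra.
- have -> : 2 * c * rho ^+ 2 / (12 * T%:R ^+ 2)
      = eps ^+ 2 / sigma / 600 * ((c / sigma) / T%:R ^+ 2).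
    by rewrite /rho; field; rewrite !gt_eqF.
  have -> : eps ^+ 2 / sigma / (54 * 10 ^+ 2) = eps ^+ 2 / sigma / 600 * (1 / 9).
    by field; rewrite gt_eqF.
  have q0 : 0 <= eps ^+ 2 / sigma / 600.
    apply: divr_ge0; last exact: ler0n.
    by apply: divr_ge0; [exact: sqr_ge0 | exact: ltW].
  apply: (ler_wpM2l q0).
  rewrite ler_pdivlMr// -kk.
  have : T%:R ^+ 2 <= (3 * k) ^+ 2 by rewrite ler_sqr ?nnegrE ?(ltW T0)//; lra.
  rewrite exprMn; lra.
Qed.

Lemma epoch_count_bounds (a x : R) (N := (Num.truncn (a * x)).+1) :
  0 <= a -> 1 <= x -> a * x < N%:R /\ N%:R <= (a + 1) * x.
Proof.
move=> a0 x1; have x0 : 0 <= a * x by rewrite mulr_ge0// (le_trans _ x1).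
have /andP[] := truncn_itv x0; rewrite /N -natr1 => le gt; split=> //.
lra.
Qed.

(** In terms of the fourth roots [l] and [e], [sigma] is [(l * e) ^ 2] and the identity becomes
    rational. *)
Lemma rate_eq (L2 Delta eps cd : R) (sigma := Num.sqrt (L2 * eps)) :
  0 < L2 -> 0 < eps -> 0 <= cd ->
  Delta * L2 `^ (1 / 4) * cd `^ (1 / 2) / eps `^ (7 / 4)
    = Delta * sigma / eps ^+ 2 * Num.sqrt (cd / sigma).
Proof.
move=> L20 e0 cd0.
set l := L2 `^ (1 / 4); set e := eps `^ (1 / 4).
have l0 : 0 < l by exact: powR_gt0.
have e40 : 0 < e by exact: powR_gt0.
have pow (x : R) n : 0 < x -> x `^ (1 / 4) ^+ n = x `^ (n%:R / 4).
  by move=> x0; rewrite -powR_mulrn ?powR_ge0// -powRrM mul1r mulrC.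
have lE : l ^+ 4 = L2 by rewrite pow// divff// powRr1// ltW.
have eE : e ^+ 4 = eps by rewrite pow// divff// powRr1// ltW.
have e7 : eps `^ (7 / 4) = e ^+ 7 by rewrite pow.
have sE : sigma = (l * e) ^+ 2.
  rewrite /sigma -lE -eE -exprMn (_ : _ ^+ 4 = ((l * e) ^+ 2) ^+ 2).
    by rewrite sqrtr_sqr ger0_norm ?sqr_ge0.
  by rewrite -exprM.
have cE : Num.sqrt (cd / sigma) = cd `^ (1 / 2) / (l * e).
  rewrite sqrtrM// mul1r powR12_sqrt// sqrtrV ?sE ?sqr_ge0//.
  by rewrite sqrtr_sqr ger0_norm// mulr_ge0// ltW.
by rewrite cE e7 sE -eE; field; rewrite !gt_eqF.
Qed.

(** Each half of the bound on [eps] gives one conclusion. The second one lets the number of epochs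
    be rounded up at the cost of a constant factor. *)
Lemma rate_ge1 (L1 L2 Delta eps : R) (sigma := Num.sqrt (L2 * eps)) :
  0 < L1 -> 0 < L2 -> 0 < Delta -> 0 < eps ->
  eps <= Num.min (L1 ^+ 2 * L2^-1) (Delta `^ (2 / 3) * L2 `^ (1 / 3)) ->
  sigma <= L1 /\ 1 <= Delta * sigma / eps ^+ 2.
Proof.
move=> L10 L20 D0 e0; rewrite le_min => /andP[e1 e2]; split.
  rewrite -(ger0_norm (ltW L10)) -sqrtr_sqr ler_wsqrtr//.
  by rewrite mulrC -ler_pdivlMr.
have s0 : 0 < sigma by rewrite sqrtr_gt0 mulr_gt0.
have sE : sigma ^+ 2 = L2 * eps by rewrite sqr_sqrtr// mulr_ge0// ltW.
rewrite ler_pdivlMr ?exprn_gt0// mul1r.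
rewrite -ler_sqr ?nnegrE ?sqr_ge0 ?mulr_ge0 ?(ltW D0) ?(ltW s0)//.
rewrite (exprMn _ Delta) sE -exprM.
have pow (x y : R) : 0 < x -> (x `^ (y / 3)) ^+ 3 = x `^ y.
  by move=> x0; rewrite -powR_mulrn ?powR_ge0// -powRrM divfK.
have : eps ^+ 3 <= Delta ^+ 2 * L2.
  apply: (@le_trans _ _ ((Delta `^ (2 / 3) * L2 `^ (1 / 3)) ^+ 3)).
    by rewrite lerXn2r ?nnegrE ?mulr_ge0 ?powR_ge0// ltW.
  by rewrite exprMn !pow// powRr1 ?(ltW L20)// powR_mulrn// ltW.
by move=> /(ler_wpM2r (ltW e0)); rewrite mulrA -exprSr.
Qed.

End Constants.

(** * The three regimes and their query counts *)

Section Regimes.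
Variables (R : realType) (d : nat) (L1 L2 Delta delta : R).
Variables (f : 'rV[R]_d -> R) (H : 'rV[R]_d -> 'M[R]_d).
Variables (x0 : 'rV[R]_d) (nH : nat) (eps : R).
Hypotheses (L1_gt0 : 0 < L1) (L2_gt0 : 0 < L2) (Delta_gt0 : 0 < Delta).
Hypotheses (delta_ge0 : 0 <= delta) (f2 : twice_differentiable f).
Hypotheses (L1f : lipschitz_grad L1 f) (L2f : lipschitz_hess L2 f).
Hypotheses (H_approx : approx_hess_oracle delta f H).
Hypotheses (nH_gt0 : (0 < nH)%N) (eps_gt0 : 0 < eps).

Let sigma := Num.sqrt (L2 * eps).
Let rho := eps / sigma / 10.
Let N0 := Delta * sigma / eps ^+ 2.
Let cd := delta + Delta * L2 / (nH%:R * eps).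
Let flow := f x0 - Delta.
Let T c := epoch_steps sigma c.

Hypotheses (f_low : forall x, flow <= f x).
Hypotheses (sigma_L1 : sigma <= L1) (N0_ge1 : 1 <= N0).

Variables (N : nat) (a : R).
Hypotheses (a_ge1 : 1 <= a) (N_gt : a * N0 < N%:R) (N_le : N%:R <= (a + 1) * N0).
Hypothesis gain_ge : forall c, sigma <= c ->
  eps ^+ 2 / sigma / a <= 2 * c * rho ^+ 2 / (12 * (T c)%:R ^+ 2).

Let sigma_gt0 : 0 < sigma. Proof. by rewrite sqrtr_gt0 mulr_gt0. Qed.
Let sigmaE : sigma ^+ 2 = L2 * eps.
Proof. by rewrite sqr_sqrtr// mulr_ge0// ltW. Qed.
Let rho_gt0 : 0 < rho. Proof. by rewrite !divr_gt0. Qed.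
Let nHR_gt0 : 0 < nH%:R :> R. Proof. by rewrite ltr0n. Qed.
Let a_gt0 : 0 < a. Proof. exact: lt_le_trans ltr01 a_ge1. Qed.

Lemma gain_total c n : sigma <= c -> (N <= n)%N ->
  f x0 - flow < n%:R * (2 * c * rho ^+ 2 / (12 * (T c)%:R ^+ 2)).
Proof.
move=> sc Nn; have -> : f x0 - flow = Delta by rewrite /flow subKr.
have nN : N%:R <= n%:R :> R by rewrite ler_nat.
have g0 : 0 < eps ^+ 2 / sigma / a.
  by apply: divr_gt0 => //; apply: divr_gt0 => //; exact: exprn_gt0.
apply: lt_le_trans (ler_wpM2l (ler0n _ n) (gain_ge sc)).
apply: lt_le_trans (ler_wpM2r (ltW g0) nN).
have -> : Delta = a * N0 * (eps ^+ 2 / sigma / a).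
  by rewrite /N0; field; rewrite !gt_eqF.
by rewrite ltr_pM2r.
Qed.

Lemma smooth_regime :
  succeeds f H eps (N * T L1) 0
    (epochs 0 L1 rho (T L1) N x0 (@Output R d)).
Proof.
have [T1 T2 _] := epoch_parameters sigma_gt0 eps_gt0 sigmaE sigma_L1.
rewrite -[(N * _)%N]addn0.
apply: (epochs_succeeds (L2 := L2)) => //.
- exact: ltW.
- exact: trmx0.
- by move=> y z _ _; rewrite mulmx0 subr0.
- move=> z fz; have := f_low z.
  by have := gain_total sigma_L1 (leqnn N); move: fz; rewrite -/(T L1); lra.
Qed.

(** [m] epochs share one Hessian. Since [m * nH > N], the number [J] of blocks stays within [nH],
    while [J * m > N] still exhausts [Delta]. *)
Let m := (N %/ nH).+1.
Let J := (N %/ m).+1.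
Let c := delta + m%:R * sigma.

Let m_ge1 : 1 <= m%:R :> R. Proof. by rewrite ler1n. Qed.
Let sigma_c : sigma <= c.
Proof.
rewrite /c; have : 1 * sigma <= m%:R * sigma by rewrite ler_wpM2r// ltW.
have := delta_ge0; lra.
Qed.

Lemma hess_regime :
  succeeds f H eps (J * (m * T c)) nH (hess_epochs c rho (T c) m J x0).
Proof.
have [T1 T2 _] := epoch_parameters sigma_gt0 eps_gt0 sigmaE sigma_c.
have JnH : (J <= nH)%N.
  by rewrite /J ltn_divLR// mulnC /m ltn_ceil.
have [h1 h2 h3] : succeeds f H eps (J * (m * T c)) J (hess_epochs c rho (T c) m J x0).
  have c_gt0 : 0 < c by exact: lt_le_trans sigma_gt0 sigma_c.
  have T_gt0 : (0 < T c)%N by [].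
  apply: (hess_epochs_succeeds f2 L2f (ltW L2_gt0) H_approx f_low c_gt0 rho_gt0
    T_gt0 T1 T2).
    have -> : L2 * (m%:R * (3 * rho) + 5 * rho) = (m%:R * 3 + 5) / 10 * sigma.
      have -> : L2 = sigma ^+ 2 / eps by rewrite sigmaE mulfK ?gt_eqF.
      by rewrite /rho; field; rewrite !gt_eqF.
    (* The drift of a block is absorbed because [(3 m + 5) / 10 <= m] for [m >= 1]. *)
    rewrite /c lerD2l ler_wpM2r ?(ltW sigma_gt0)//.
    by have := m_ge1; lra.
  apply: gain_total sigma_c _.
  by rewrite /J mulnC; apply: ltnW; rewrite mulnC ltn_ceil.
by split=> //; exact: leq_trans h3 JnH.
Qed.

Lemma count_le n c' b x : sigma <= c' -> 0 <= b ->
  (n <= 3 * N)%N -> c' <= b * x -> 0 <= x ->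
  (n * T c')%:R <= 9 * (a + 1) * Num.sqrt b * (N0 * Num.sqrt (x / sigma)).
Proof.
move=> sc b0 nN cx x_ge0.
have [_ T3] := epoch_steps_bounds sigma_gt0 sc.
have k : Num.sqrt (c' / sigma) <= Num.sqrt b * Num.sqrt (x / sigma).
  by rewrite -sqrtrM// ler_wsqrtr// mulrA ler_wpM2r// invr_ge0 ltW.
have nN' : n%:R <= 3 * ((a + 1) * N0).
  apply: (@le_trans _ _ (3 * N%:R)); last by rewrite ler_wpM2l.
  by rewrite -natrM ler_nat.
rewrite natrM.
have -> : 9 * (a + 1) * Num.sqrt b * (N0 * Num.sqrt (x / sigma))
   = (3 * ((a + 1) * N0)) * (3 * (Num.sqrt b * Num.sqrt (x / sigma))) by ring.
apply: ler_pM => //; apply: le_trans T3 _.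
by rewrite ler_wpM2l.
Qed.

(** [N0 / nH * sigma] is exactly the second summand of [cd]. Rounding [m] up adds one [sigma], which
    the hypothesis pays for. *)
Lemma c_le b : sigma <= b * cd -> c <= (a + 1 + b) * cd.
Proof.
move=> sb.
have mE : m%:R <= (a + 1) * N0 / nH%:R + 1.
  rewrite /m -natr1 lerD2r ler_pdivlMr// -natrM.
  by apply: le_trans N_le; rewrite ler_nat leq_trunc_div.
have h : N0 / nH%:R * sigma = Delta * L2 / (nH%:R * eps).
  have -> : L2 = sigma ^+ 2 / eps by rewrite sigmaE mulfK ?gt_eqF.
  by rewrite /N0; field; rewrite !gt_eqF.
have : m%:R * sigma <= ((a + 1) * N0 / nH%:R + 1) * sigma.
  by rewrite ler_wpM2r// ltW.
have -> : ((a + 1) * N0 / nH%:R + 1) * sigma = (a + 1) * (N0 / nH%:R * sigma) + sigma.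
  by ring.
rewrite h /c.
have : delta <= (a + 1) * delta.
  by rewrite ler_peMl//; have := a_ge1; lra.
move: sb; rewrite /cd; lra.
Qed.

Lemma epochs_count : (J * m <= 3 * N)%N.
Proof.
have N0' : (0 < N)%N.
  rewrite -(ltr_nat R); apply: lt_trans N_gt.
  by rewrite mulr_gt0// (lt_le_trans _ N0_ge1).
rewrite /J mulSn addnC.
have h1 := leq_trunc_div N m.
have h2 : (m <= N.+1)%N by rewrite /m ltnS leq_div.
apply: (@leq_trans (N + N.+1)); first exact: leq_add.
by rewrite mulSn leq_add2l mul2n -addnn -addn1 leq_add2l.
Qed.

Section SmallError.
Hypothesis cd_small : cd < sigma / 10 ^+ 3.

(** [e] is the transport error of one step, and [q] steps keep the total within [eps / 40]. Since
    [b * r = eps / 10], each step gains [r * eps / 40], so [nH / 2] steps already gain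
    [5/4 * Delta]. *)
Let r := 10 ^+ 2 * Delta / (nH%:R * eps).
Let e := (delta + L2 * r) * r.
Let q := minn (Num.truncn (eps / (40 * e))) nH.
Let b := eps / (10 * r).

Let r_gt0 : 0 < r.
Proof.
by apply: divr_gt0; [apply: mulr_gt0 => //; exact: exprn_gt0 | exact: mulr_gt0].
Qed.

Let cd_gt0 : 0 < cd.
Proof. by rewrite /cd ltr_wpDl// divr_gt0 ?mulr_gt0. Qed.

Let err_le : delta + L2 * r <= 10 ^+ 2 * cd.
Proof.
have -> : L2 * r = 10 ^+ 2 * (Delta * L2 / (nH%:R * eps)) by rewrite /r; ring.
rewrite /cd; have := delta_ge0; lra.
Qed.

Let r_cd : L2 * r <= 10 ^+ 2 * cd.
Proof. by have := err_le; have := delta_ge0; lra. Qed.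

(** After multiplication by [L2], both factors on the left are at most [100 * cd <= sigma / 10], and
    [sigma ^ 2 = L2 * eps]. *)
Let cdr : (10 ^+ 2 * cd) * r <= eps / 10 ^+ 2.
Proof.
rewrite -(ler_pM2l L2_gt0).
have -> : L2 * (10 ^+ 2 * cd * r) = (10 ^+ 2 * cd) * (L2 * r) by ring.
have -> : L2 * (eps / 10 ^+ 2) = sigma ^+ 2 / 10 ^+ 2 by rewrite sigmaE mulrA.
apply: (@le_trans _ _ ((10 ^+ 2 * cd) * (10 ^+ 2 * cd))).
  by rewrite ler_wpM2l// mulr_ge0// ?exprn_ge0// ltW.
have : (10 ^+ 2 * cd) * (10 ^+ 2 * cd) <= (sigma / 10) * (sigma / 10).
  have h0 : 0 <= 10 ^+ 2 * cd by rewrite mulr_ge0// ?exprn_ge0// ltW.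
  have h1 : 10 ^+ 2 * cd <= sigma / 10 by have := cd_small; lra.
  by apply: ler_pM.
by move=> h; apply: le_trans h _; rewrite le_eqVlt; apply/orP; left;
  apply/eqP; field.
Qed.

Let e_gt0 : 0 < e.
Proof. by rewrite /e mulr_gt0// ltr_wpDl// mulr_gt0. Qed.

Let e_le : e <= 10 ^+ 2 * cd * r.
Proof. by rewrite /e ler_wpM2r// ltW. Qed.

Let q_ge1 : 1 <= eps / (40 * e).
Proof.
have h : 0 < 40 * e by exact: mulr_gt0.
rewrite (ler_pdivlMr _ _ h) mul1r.
by have := le_trans e_le cdr; have := eps_gt0; lra.
Qed.

Let q_gt0 : (0 < q)%N.
Proof. by rewrite /q leq_min nH_gt0 truncn_gt0 q_ge1. Qed.

Lemma small_error_regime :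
  succeeds f H eps (nH %/ q) nH (walks b r q (nH %/ q) x0).
Proof.
have b_gt0 : 0 < b by apply: divr_gt0 => //; exact: mulr_gt0.
have qnH : (q <= nH)%N by exact: geq_minr.
have bE : b * r = eps / 10 by rewrite /b; field; rewrite gt_eqF.
have gainE : b * r ^+ 2 / 2 - r * (eps / 40) = r * eps / 40.
  by rewrite expr2 mulrA bE; field.
have [h1 h2 h3] : succeeds f H eps (nH %/ q) (nH %/ q * q)
    (walks b r q (nH %/ q) x0).
  apply: (walks_succeeds f2 L2f (ltW L2_gt0) H_approx f_low (a := e)
    (emax := eps / 40) b_gt0 r_gt0).
  - apply: le_trans err_le _; rewrite -(ler_pM2r r_gt0) bE.
    by apply: le_trans cdr _; have := eps_gt0; lra.
  - exact: lexx.
  - by rewrite -mulrA bE; have := eps_gt0; lra.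
  - have qe : q%:R <= eps / (40 * e).
      apply: (@le_trans _ _ (Num.truncn (eps / (40 * e)))%:R).
        by rewrite ler_nat geq_minl.
      by rewrite truncn_le (le_trans _ q_ge1).
    apply: le_trans (ler_wpM2r (ltW e_gt0) qe) _.
    by rewrite le_eqVlt; apply/orP; left; apply/eqP; field; rewrite gt_eqF.
  - rewrite gainE /flow subKr.
    (* Rounding [nH] down to a multiple of [q] loses at most half, because [q <= nH]. *)
    have half : nH%:R <= 2 * (nH %/ q * q)%:R :> R.
      rewrite -natrM ler_nat mul2n -addnn {1}(divn_eq nH q) leq_add2l.
      apply: leq_trans (ltnW (ltn_pmod _ q_gt0)) _.
      by rewrite leq_pmull// divn_gt0.
    apply: lt_le_trans (_ : nH%:R / 2 * (r * eps / 40) <= _); last first.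
      apply: ler_wpM2r; last by rewrite ler_pdivrMr// mulrC.
      by rewrite divr_ge0// mulr_ge0// ltW.
    have -> : nH%:R / 2 * (r * eps / 40) = Delta * (10 ^+ 2 / 80).
      by rewrite /r; field; rewrite !gt_eqF.
    by have := Delta_gt0; lra.
by split=> //; apply: leq_trans h3 _; exact: leq_trunc_div.
Qed.

(** If [q = nH], a single gradient suffices. Otherwise [q] is at least half of [eps / (40 * e)],
    which gives a count of order [N0 * (cd / sigma)]. Since [cd / sigma <= 1], replacing this ratio
    by its square root only increases the bound. *)
Lemma small_error_count :
  (nH %/ q)%:R <= 8 * 10 ^+ 5 * Num.max 1 (N0 * Num.sqrt (cd / sigma)).
Proof.
set M := Num.max _ _.
have M1 : 1 <= M by rewrite le_max lexx.
have [qE|qlt] := eqVneq q nH.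
  have -> : (nH %/ q)%:R = 1 :> R by rewrite qE divnn nH_gt0.
  lra.
have qE : q = Num.truncn (eps / (40 * e)).
  by move: qlt; rewrite /q /minn; case: ifP => // _; rewrite eqxx.
have eq0 : 0 <= eps / (40 * e) by apply: le_trans q_ge1.
have q_half : eps / (40 * e) <= 2 * q%:R.
  have /andP[_] := truncn_itv eq0; rewrite -qE -natr1.
  have : 1 <= q%:R :> R by rewrite ler1n.
  lra.
have cs : cd / sigma <= Num.sqrt (cd / sigma).
  have k0 := sqrtr_ge0 (cd / sigma).
  have k1 : Num.sqrt (cd / sigma) <= 1.
    rewrite -sqrtr1 ler_wsqrtr// ler_pdivrMr// mul1r.
    by have := cd_small; have := sigma_gt0; lra.
  rewrite -{1}(@sqr_sqrtr _ (cd / sigma)) ?expr2; last first.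
    by rewrite divr_ge0// ltW.
  by rewrite ler_piMr.
have JE : (nH %/ q)%:R * q%:R <= nH%:R :> R.
  by rewrite -natrM ler_nat leq_trunc_div.
have J0 : 0 <= (nH %/ q)%:R :> R by rewrite ler0n.
have : (nH %/ q)%:R * (eps / (40 * e)) <= 2 * nH%:R.
  have := ler_wpM2l J0 q_half; lra.
have e40 : 0 < 40 * e by exact: mulr_gt0.
rewrite mulrA (ler_pdivrMr _ _ e40) => h.
have h2 : (nH %/ q)%:R * eps <= 80 * (nH%:R * (10 ^+ 2 * cd * r)).
  have : nH%:R * e <= nH%:R * (10 ^+ 2 * cd * r) by rewrite ler_wpM2l// ltW.
  lra.
have rE : nH%:R * (10 ^+ 2 * cd * r) = 10 ^+ 4 * (Delta * cd / eps).
  by rewrite /r; field; rewrite !gt_eqF.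
rewrite rE in h2.
have h3 : (nH %/ q)%:R <= 8 * 10 ^+ 5 * (N0 * (cd / sigma)).
  rewrite -(ler_pM2r eps_gt0); apply: le_trans h2 _.
  by rewrite le_eqVlt; apply/orP; left; apply/eqP; rewrite /N0; field;
    rewrite !gt_eqF.
have h4 : N0 * (cd / sigma) <= M.
  apply: (@le_trans _ _ (N0 * Num.sqrt (cd / sigma))); last first.
    by rewrite le_max lexx orbT.
  by rewrite ler_wpM2l// (le_trans _ N0_ge1).
apply: le_trans h3 _; apply: ler_wpM2l h4.
by apply: mulr_ge0 => //; exact: exprn_ge0.
Qed.

End SmallError.
End Regimes.

(** * The combined algorithm and its complexity *)

Definition hybrid (R : realType) : algorithm R :=
  fun d L1 L2 Delta delta eps nH x0 =>
  let sigma := Num.sqrt (L2 * eps) in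
  let rho := eps / sigma / 10 in
  let N := (Num.truncn (54 * 10 ^+ 2 * (Delta * sigma / eps ^+ 2))).+1 in
  let cd := delta + Delta * L2 / (nH%:R * eps) in
  if cd < sigma / 10 ^+ 3 then
    let r := 10 ^+ 2 * Delta / (nH%:R * eps) in
    let q := minn (Num.truncn (eps / (40 * ((delta + L2 * r) * r)))) nH in
    walks (eps / (10 * r)) r q (nH %/ q) x0
  else if L1 <= cd then
    epochs 0 L1 rho (epoch_steps sigma L1) N x0 (@Output R d)
  else
    let m := (N %/ nH).+1 in
    let c := delta + m%:R * sigma in
    hess_epochs c rho (epoch_steps sigma c) m (N %/ m).+1 x0.

Lemma bounded_subopt_lower (R : realType) (d : nat) (Delta : R)
    (f : 'rV[R]_d -> R) (x0 x : 'rV[R]_d) :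
  bounded_subopt Delta f x0 -> f x0 - Delta <= f x.
Proof.
rewrite /bounded_subopt => h; rewrite lerBlDr -lerBlDl -lee_fin EFinB.
apply: le_trans h; apply: leeB => //; apply: ereal_inf_lbound.
by exists x.
Qed.

Unset Implicit Arguments.

Theorem theorem1 (R : realType) :
  exists (C : R) (p : {poly R}) (A : algorithm R),
    0 < C /\
    forall (d : nat) (L1 L2 Delta delta : R) (f : 'rV[R]_d -> R)
      (H : 'rV[R]_d -> 'M[R]_d) (x0 : 'rV[R]_d) (nH : nat) (eps : R),
      0 < L1 -> 0 < L2 -> 0 < Delta -> 0 <= delta ->
      twice_differentiable f -> lipschitz_grad L1 f -> lipschitz_hess L2 f ->
      approx_hess_oracle delta f H ->
      bounded_subopt Delta f x0 ->
      (0 < nH)%N ->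
      0 < eps ->
      eps <= Num.min (L1 ^+ 2 * L2^-1) (Delta `^ (2 / 3) * L2 `^ (1 / 3)) ->
      let o := run (grad f) H (A d L1 L2 Delta delta eps nH x0) in
      [/\ critical eps f (result o),
          (hess_queries o <= nH)%N
        & (grad_queries o)%:R
            <= C * Num.max 1 (grad_rate p L1 L2 Delta delta eps nH)].
Proof.
(* [a] is the inverse gain of an epoch from [epoch_parameters], and [b] is the threshold of the
   small-error regime in [hybrid]. *)
pose a : R := 54 * 10 ^+ 2; pose b : R := 10 ^+ 3.
have a_ge1 : 1 <= a by rewrite /a; lra.
have b_ge1 : 1 <= b by rewrite /b; lra.
pose k := Num.sqrt (a + 1 + b).
have k_ge1 : 1 <= k by rewrite -sqrtr1 ler_wsqrtr//; lra.
pose C1 := 9 * (a + 1) * k; pose C := C1 + 8 * 10 ^+ 5.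
have C1_gt0 : 0 < C1 by rewrite !mulr_gt0//; lra.
have W_gt0 : 0 < 8 * 10 ^+ 5 :> R by lra.
exists C, 1, (@hybrid R); split; first by rewrite addr_gt0.
move=> d L1 L2 Delta delta f H x0 nH eps L10 L20 D0 d0 f2 L1f L2f Ha sub nH0 e0.
move=> ebound.
have low x := @bounded_subopt_lower R d Delta f x0 x sub.
have [sL1 N0] := rate_ge1 L10 L20 D0 e0 ebound.
set sigma := Num.sqrt (L2 * eps) in sL1 N0.
have s0 : 0 < sigma by rewrite sqrtr_gt0 mulr_gt0.
have sE : sigma ^+ 2 = L2 * eps by rewrite sqr_sqrtr// mulr_ge0// ltW.
pose cd := delta + Delta * L2 / (nH%:R * eps).
have cd0 : 0 <= cd.
  by rewrite addr_ge0// divr_ge0// mulr_ge0 ?ler0n// ltW.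
pose rate x := Delta * sigma / eps ^+ 2 * Num.sqrt (x / sigma).
have rateE : grad_rate 1 L1 L2 Delta delta eps nH = rate (Num.min L1 cd).
  rewrite /grad_rate hornerC mulr1 rate_eq//.
  by rewrite le_min (ltW L10) cd0.
have [Ngt Nle] := epoch_count_bounds (le_trans ler01 a_ge1) N0.
set N := (Num.truncn _).+1 in Ngt Nle.
have gain c : sigma <= c -> _ := fun sc => let: And3 _ _ g :=
  epoch_parameters s0 e0 sE sc in g.
have finish (n h : nat) (prog : oracle_prog R d) :
    succeeds f H eps n h prog -> (h <= nH)%N ->
    n%:R <= C * Num.max 1 (rate (Num.min L1 cd)) ->
    let o := run (grad f) H prog in
    [/\ critical eps f (result o), (hess_queries o <= nH)%N
      & (grad_queries o)%:R <= C * Num.max 1 (grad_rate 1 L1 L2 Delta delta eps nH)].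
  move=> [h1 h2 h3] hn nC; split=> //; first exact: leq_trans h3 hn.
  by rewrite rateE; apply: le_trans nC; rewrite ler_nat.
have fin1 (n : nat) (x : R) : n%:R <= C1 * rate x ->
    n%:R <= C * Num.max 1 (rate x).
  move=> h; apply: (le_trans h).
  apply: (@le_trans _ _ (C1 * Num.max 1 (rate x))).
    by apply: (ler_wpM2l (ltW C1_gt0)); rewrite le_max lexx orbT.
  apply: ler_wpM2r; first by rewrite le_max ler01.
  by rewrite /C lerDl ltW.
rewrite /hybrid -/sigma -/cd -/N; case: ifP => [cds|/negbT]; last first.
  rewrite -leNgt => cds; case: ifP => [L1cd|/negbT].
    apply: finish (leq0n nH) _.
      exact: (smooth_regime H L10 L20 f2 L1f L2f e0 low sL1 a_ge1 Ngt gain).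
    apply: fin1; rewrite (min_idPl L1cd).
    have := count_le L20 e0 Nle sL1 (b := 1) (x := L1) (n := N).
    rewrite mul1r sqrtr1 => /(_ ler01 _ (lexx _) (ltW L10))/le_trans; apply.
      by rewrite leq_pmull.
    have r0 : 0 <= rate L1.
      rewrite /rate mulr_ge0 ?sqrtr_ge0//; exact: le_trans N0.
    have a9 : 0 < 9 * (a + 1) by apply: mulr_gt0 => //; lra.
    by apply: ler_wpM2r => //; rewrite /C1 (ler_pM2l a9).
  rewrite -ltNge => cdL1.
  apply: finish (leqnn nH) _.
    exact: (hess_regime L20 d0 f2 L2f Ha nH0 e0 low a_ge1 Ngt gain).
  apply: fin1; rewrite (min_idPr (ltW cdL1)).
  set m := (N %/ nH).+1; pose c := delta + m%:R * sigma.
  have sb : sigma <= b * cd by move: cds; rewrite ler_pdivrMr// mulrC.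
  have sc : sigma <= c.
    have : 1 * sigma <= m%:R * sigma by rewrite ler_wpM2r ?(ltW s0)// ler1n.
    by rewrite /c; lra.
  have cle : c <= (a + 1 + b) * cd by exact: (c_le L20 d0 nH0 e0 a_ge1 Nle sb).
  rewrite mulnA; apply: (count_le L20 e0 Nle sc _ _ cle cd0).
    by lra.
  exact: (epochs_count nH N0 a_ge1 Ngt).
apply: finish (leqnn nH) _.
  exact: (small_error_regime L20 D0 d0 f2 L2f Ha nH0 e0 low cds).
(* Here [cd < sigma / 10 ^ 3] and [sigma <= L1], so the minimum in [c_delta] is [cd]. *)
have cdL1 : cd <= L1.
  by apply: ltW; apply: lt_le_trans cds _; move: sL1; lra.
rewrite (min_idPr cdL1).
apply: le_trans (small_error_count L20 D0 d0 nH0 e0 N0 cds) _.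
apply: ler_wpM2r; first by rewrite le_max ler01.
by rewrite /C lerDr ltW.
Qed.
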